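(* Let $N\ge2$, $n\ge1$, $\lambda\in\mathbb{C}$, $\tau'\in\{1,-1\}$, and suppose $\beta=\tau'\lambda$. Define $\mathcal{T}_0(u)=\mathcal{L}_{01}(u)\cdots\mathcal{L}_{0N}(u)$ with $\mathcal{L}_{0i}(u)=\frac{u+d_i}{u+d_i-\lambda}\big(1-\frac{\lambda P_{0i}}{u+d_i}\big)$. Then $$R_{00'}(u-v)\,\mathcal{T}_0(u)\Lambda^{(1)}\,\mathcal{T}_{0'}(v)\Lambda^{(1)}=\mathcal{T}_{0'}(v)\Lambda^{(1)}\,\mathcal{T}_0(u)\Lambda^{(1)}\,R_{00'}(u-v),$$ and $\mathrm{qdet}\big(\mathcal{T}(u)\Lambda^{(1)}\big)=\big(\mathrm{qdet}\,\mathcal{T}(u)\big)\Lambda^{(1)}$.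
   Context: The degenerate affine Hecke algebra $\widetilde{\mathcal{A}}(N)$ with parameter $\beta\in\mathbb{C}$ is the unital associative complex algebra generated by $d_1,\dots,d_N$ and $\mathcal{P}_{i,i+1}$ ($1\le i\le N-1$) with relations $\mathcal{P}_{i,i+1}\mathcal{P}_{i+1,i+2}\mathcal{P}_{i,i+1}=\mathcal{P}_{i+1,i+2}\mathcal{P}_{i,i+1}\mathcal{P}_{i+1,i+2}$, $\mathcal{P}_{i,i+1}^2=1$, $\mathcal{P}_{i,i+1}d_k=d_k\mathcal{P}_{i,i+1}$ ($k\ne i,i+1$), $\mathcal{P}_{i,i+1}d_i=d_{i+1}\mathcal{P}_{i,i+1}+\beta$, $\mathcal{P}_{i,i+1}d_{i+1}=d_i\mathcal{P}_{i,i+1}-\beta$, $[d_i,d_j]=0$; for $i<j$, $\mathcal{P}_{ij}=\mathcal{P}_{i,i+1}\cdots\mathcal{P}_{j-2,j-1}\mathcal{P}_{j-1,j}\mathcal{P}_{j-2,j-1}\cdots\mathcal{P}_{i,i+1}$. We work in $\widetilde{\mathcal{A}}(N)\otimes\mathrm{End}(\mathbb{C}^n)^{\otimes(N+2)}$, with auxiliary spaces $0,0'$ and quantum spaces $1,\dots,N$; elements of $\widetilde{\mathcal{A}}(N)$ commute with all matrices. $P_{ab}$ permutes tensor factors $a,b$; $R_{ab}(u)=1-\lambda P_{ab}/u$. Rational expressions in $u$ and $d_i$ are expanded as formal power series in $u^{-1}$. $\Lambda^{(1)}=\frac{1}{N!}\prod_{j=2}^{N}\big(1+\tau'\sum_{i=1}^{j-1}P_{ij}\mathcal{P}_{ij}\big)$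 (with $P_{ij}$ acting on quantum spaces). Quantum determinant: for a matrix series $X(u)$, with $n$ auxiliary copies $1,\dots,n$ and $A_n$ the antisymmetrizer on $(\mathbb{C}^n)^{\otimes n}$, $\mathrm{qdet}\,X(u)$ is defined by $A_n\,\mathrm{qdet}\,X(u)=A_n X_1(u)X_2(u-\lambda)\cdots X_n(u-n\lambda+\lambda)$.
   Formalization: The standard relation that P_{i,i+1} and P_{j,j+1} commute for |i-j|>=2, missing from the listed relations of the degenerate affine Hecke algebra, is assumed; without it the quantum determinant claim fails (e.g. N=4, n=2, lambda=0). *)

(* Defs.v *)
From HB Require Import structures.
From mathcomp Require Import all_boot all_order all_algebra all_fingroup.
From mathcomp Require Export reals complex.

Set Implicit Arguments. Unset Strict Implicit. Unset Printing Implicit Defensive.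
Import Order.TTheory GRing.Theory Num.Theory.
Local Open Scope ring_scope.

(* Operators on (C^n)^{(x) M} with coefficients in an algebra A.      *)
(* A (x) End(C^n)^{(x) M} is represented as square matrices with      *)
(* entries in A, indexed by multi-indices x : 'I_M -> 'I_n (the basis *)
(* e_{x 0} (x) ... (x) e_{x (M-1)}).  A-elements act as scalar        *)
(* matrices a%:M and hence commute with all complex matrices.          *)

Definition idx (n M : nat) := {ffun 'I_M -> 'I_n}.

Definition op (A : pzRingType) (n M : nat) := 'M[A]_(#|idx n M|).

Definition eidx (n M : nat) (x : 'I_#|idx n M|) : idx n M := enum_val x.

Definition cs (C : fieldType) (A : lalgType C) (n M : nat) (c : C) : op A n M :=
  (c%:A : A)%:M.

Definition asop (A : pzRingType) (n M : nat) (a : A) : op A n M := a%:M.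

Definition Pmx (A : pzRingType) (n M : nat) (a b : 'I_M) : op A n M :=
  \matrix_(x, y) ((eidx x == [ffun p => eidx y (tperm a b p)])%:R : A).

(* the operator X acting on factors s(0),...,s(M-1) of (C^n)^{(x) M'}  *)
(* (tensored with the identity on the other factors); s injective.     *)
Definition emb (A : pzRingType) (n M M' : nat) (s : 'I_M -> 'I_M')
    (X : op A n M) : op A n M' :=
  \matrix_(x, y)
    (X (enum_rank [ffun p => eidx x (s p)]) (enum_rank [ffun p => eidx y (s p)])
     * ([forall p, (p \notin codom s) ==> (eidx x p == eidx y p)])%:R).

(* Formal power series in u^{-1}: f k is the coefficient of u^{-k}.   *)

Definition ser (S : Type) := nat -> S.

Definition ser_cst (S : pzRingType) (x : S) : ser S :=
  fun k => if k == 0%N then x else 0.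

Definition ser_add (S : pzRingType) (f g : ser S) : ser S := fun k => f k + g k.
Definition ser_opp (S : pzRingType) (f : ser S) : ser S := fun k => - f k.

Definition ser_mul (S : pzRingType) (f g : ser S) : ser S :=
  fun k => \sum_(i < k.+1) f i * g (k - i)%N.

Definition ser_prod (S : pzRingType) (fs : seq (ser S)) : ser S :=
  foldr (@ser_mul S) (ser_cst 1) fs.

Definition ser_lin (S : pzRingType) (c : S) : ser S :=
  fun k => if k == 0%N then 1 else if k == 1%N then c else 0.

(* (1 + c u^{-1})^{-1} = sum_k (-c)^k u^{-k} *)
Definition ser_geo (S : pzRingType) (c : S) : ser S := fun k => (- c) ^+ k.

(* (u + c)^{-1} = u^{-1} (1 + c u^{-1})^{-1} = sum_k (-c)^k u^{-k-1} *)
Definition ser_inv (S : pzRingType) (c : S) : ser S :=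
  fun k => if k == 0%N then 0 else (- c) ^+ k.-1.

(* (u + c)/(u + c') = (1 + c u^{-1}) (1 + c' u^{-1})^{-1} *)
Definition ser_frac (S : pzRingType) (c c' : S) : ser S :=
  ser_mul (ser_lin c) (ser_geo c').

(* substitution u |-> u - c (c a complex number):                     *)
(* (u - c)^{-k} = sum_j 'C(k+j-1, j) c^j u^{-k-j}                      *)
Definition ser_shift (C : fieldType) (A : lalgType C) (n M : nat) (c : C)
    (f : ser (op A n M)) : ser (op A n M) :=
  fun m => \sum_(k < m.+1) f k * cs A n M (c ^+ (m - k) * ('C(m.-1, m - k))%:R).

(* Bivariate formal power series in u^{-1}, v^{-1}.                    *)

Definition bser (S : Type) := nat -> nat -> S.

Definition bser_mul (S : pzRingType) (F G : bser S) : bser S :=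
  fun k l => \sum_(i < k.+1) \sum_(j < l.+1) F i j * G (k - i)%N (l - j)%N.

Definition in_u (S : pzRingType) (f : ser S) : bser S :=
  fun k l => if l == 0%N then f k else 0.
Definition in_v (S : pzRingType) (f : ser S) : bser S :=
  fun k l => if k == 0%N then f l else 0.

Definition Rnorm (C : fieldType) (A : lalgType C) (n M : nat) (lam : C)
    (a b : 'I_M) : bser (op A n M) :=
  fun k l =>
    if (k == 0%N) && (l == 1%N) then 1
    else if (k == 1%N) && (l == 0%N) then -1
    else if (k == 1%N) && (l == 1%N) then - (cs A n M lam * Pmx A n a b)
    else 0.

(* The degenerate affine Hecke algebra.  We quantify over an arbitrary  *)
(* C-algebra A with elements d_1..d_N, P_{1,2},...,P_{N-1,N} satisfying *)
(* the defining relations (universal property).           *)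
(* d i = d_i, Pg i = P_{i,i+1} (1-based indices).                        *)

Definition dAHA_rel (C : fieldType) (A : lalgType C) (N : nat) (beta : C)
    (d Pg : nat -> A) : Prop :=
  (forall i, (1 <= i)%N -> (i.+1 <= N - 1)%N ->
         Pg i * Pg i.+1 * Pg i = Pg i.+1 * Pg i * Pg i.+1) /\
      (forall i j, (1 <= i)%N -> (i <= N - 1)%N -> (1 <= j)%N -> (j <= N - 1)%N ->
         (i.+1 < j)%N -> Pg i * Pg j = Pg j * Pg i) /\
      (forall i, (1 <= i)%N -> (i <= N - 1)%N -> Pg i * Pg i = 1) /\
      (forall i k, (1 <= i)%N -> (i <= N - 1)%N -> (1 <= k)%N -> (k <= N)%N ->
         k != i -> k != i.+1 -> Pg i * d k = d k * Pg i) /\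
      (forall i, (1 <= i)%N -> (i <= N - 1)%N ->
         Pg i * d i = d i.+1 * Pg i + beta%:A) /\
      (forall i, (1 <= i)%N -> (i <= N - 1)%N ->
         Pg i * d i.+1 = d i * Pg i - beta%:A) /\
      (forall i j, (1 <= i)%N -> (i <= N)%N -> (1 <= j)%N -> (j <= N)%N ->
         d i * d j = d j * d i).

Definition Pcal (A : pzRingType) (Pg : nat -> A) (i j : nat) : A :=
  (\prod_(i <= k < j.-1) Pg k) * Pg j.-1 * \prod_(k <- rev (index_iota i j.-1)) Pg k.

(* Objects on a space (C^n)^{(x) M}, where quantum space i (1-based,   *)
(* i = 1..N) sits at tensor position qp (i-1), qp : 'I_N -> 'I_M.      *)

Definition Lambda1 (C : fieldType) (A : lalgType C) (n M N : nat)
    (qp : 'I_N -> 'I_M) (tau : C) (Pg : nat -> A) : op A n M :=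
  cs A n M (N`!%:R)^-1 *
  \prod_(j < N | (1 <= j)%N)
     (1 + cs A n M tau *
          \sum_(i < N | (i < j)%N)
             Pmx A n (qp i) (qp j) * asop n M (Pcal Pg i.+1 j.+1)).

Definition Lser (C : fieldType) (A : lalgType C) (n M : nat) (lam : C)
    (a b : 'I_M) (di : A) : ser (op A n M) :=
  let D := asop n M di in
  ser_mul (ser_frac D (D - cs A n M lam))
          (ser_add (ser_cst 1)
                   (ser_opp (ser_mul (ser_cst (cs A n M lam * Pmx A n a b))
                                     (ser_inv D)))).

Definition Tser (C : fieldType) (A : lalgType C) (n M N : nat)
    (qp : 'I_N -> 'I_M) (lam : C) (a : 'I_M) (d : nat -> A) : ser (op A n M) :=
  ser_prod [seq Lser n lam a (qp i) (d (nat_of_ord i).+1) | i : 'I_N <- enum 'I_N].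

(* Quantum determinant.  X(u) acts on C^n (x) (quantum spaces), the    *)
(* auxiliary space being position 0 of 'I_(1+N).  Copies 1..n of the   *)
(* auxiliary space sit at positions lshift N a (a : 'I_n) of 'I_(n+N). *)

Definition aux_copy (n N : nat) (a : 'I_n) (p : 'I_(1 + N)) : 'I_(n + N) :=
  match split p with inl _ => lshift N a | inr j => rshift n j end.

Definition Pperm (A : pzRingType) (n N : nat) (s : 'S_n) : op A n (n + N) :=
  \matrix_(x, y)
    (([forall p, eidx x p ==
        eidx y (match split p with inl i => lshift N (s i) | inr j => rshift n j end)])%:R : A).

Definition antisym (C : fieldType) (A : lalgType C) (n N : nat) : op A n (n + N) :=
  cs A n (n + N) (n`!%:R)^-1 *
  \sum_(s : 'S_n) cs A n (n + N) ((-1) ^+ s) * Pperm A N s.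

Definition is_qdet (C : fieldType) (A : lalgType C) (n N : nat) (lam : C)
    (X : ser (op A n (1 + N))) (Q : ser (op A n N)) : Prop :=
  ser_mul (ser_cst (antisym A n N)) (fun k => emb (@rshift n N) (Q k))
  = ser_mul (ser_cst (antisym A n N))
      (ser_prod [seq (fun k => emb (aux_copy a) (ser_shift (a%:R * lam) X k))
                | a <- enum 'I_n]).

(* Main.v *)
Require Import Defs.
From HB Require Import structures.
From mathcomp Require Import all_boot all_order all_algebra all_fingroup.
From mathcomp Require Import reals complex.
From mathcomp Require Import boolp zify.

(* With x = 1/u, each Lax operator is (1 + d_i x - lambda P_{0i} x) times the
   inverse of 1 + (d_i - lambda) x, where x is central and the inverse commutes
   with all P_{0i}.  Everything then reduces to three exchange relations between
   two linear factors: the Yang-Baxter relation for two auxiliary spaces (RTT),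
   its degenerate case u - v = lambda, where R becomes 1 - P (fusion), and, for
   two neighbouring quantum spaces,
     Pi L_k L_{k+1} = L_k L_{k+1} Pi + (...) (lambda Pi - beta),
   with Pi = P_{k,k+1} (x) Pcal_{k,k+1}.  As beta = tau' lambda, the last
   term dies on the image of Lambda, where Pi = tau'; hence tau' Pi fixes
   T(u) Lambda, and so Lambda T(u) Lambda = T(u) Lambda, which lets every
   intermediate Lambda be dropped from products of T's.  Fusion makes
   A_n T_1(u) ... T_n(u - n lambda + lambda) alternating on both sides in the
   auxiliary indices, hence a multiple of A_n: this gives the quantum
   determinant of T(u). *)

Set Implicit Arguments. Unset Strict Implicit. Unset Printing Implicit Defensive.
Import GRing.Theory Num.Theory.
Local Open Scope ring_scope.

Local Notation central x := (forall z, GRing.comm x z).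

(** * Formal power series *)

HB.instance Definition _ (S : pzRingType) := gen_eqMixin (ser S).
HB.instance Definition _ (S : pzRingType) := gen_choiceMixin (ser S).

Section SeriesRing.
Variable S : pzRingType.
Implicit Types f g h : ser S.

Lemma ser_mul_rev f g k :
  ser_mul f g k = \sum_(i < k.+1) f (k - i)%N * g i.
Proof.
rewrite /ser_mul (reindex_inj rev_ord_inj) /=.
by apply: eq_bigr => i _; rewrite (sub_ordK i).
Qed.

Fact ser_addA : associative (@ser_add S).
Proof. by move=> f g h; apply: funext => k; apply: addrA. Qed.
Fact ser_addC : commutative (@ser_add S).
Proof. by move=> f g; apply: funext => k; apply: addrC. Qed.
Fact ser_add0 : left_id (fun _ : nat => 0 : S) (@ser_add S).
Proof. by move=> f; apply: funext => k; apply: add0r. Qed.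
Fact ser_addN : left_inverse (fun _ : nat => 0 : S) (@ser_opp S) (@ser_add S).
Proof. by move=> f; apply: funext => k; apply: addNr. Qed.

HB.instance Definition _ := GRing.isZmodule.Build (ser S)
  ser_addA ser_addC ser_add0 ser_addN.

Fact ser_mulA : associative (@ser_mul S).
Proof.
move=> f g h; apply: funext => k; rewrite [RHS]ser_mul_rev {1}/ser_mul.
pose c3 i j := f i * (g (k - i - j)%N * h j).
transitivity (\sum_(i < k.+1) \sum_(j < k.+1 | (j <= k - i)%N) c3 i j).
  apply: eq_bigr => /= i _; rewrite ser_mul_rev big_distrr /=.
  by rewrite (big_ord_narrow_leq (leq_subr _ _)).
rewrite (exchange_big_dep predT) //=; apply: eq_bigr => j _.
transitivity (\sum_(i < k.+1 | (i <= k - j)%N) c3 i j).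
  apply: eq_bigl => i; rewrite -ltnS -(ltnS i) -!subSn ?leq_ord //.
  by rewrite -subn_gt0 -(subn_gt0 i) -!subnDA addnC.
rewrite (big_ord_narrow_leq (leq_subr _ _)) big_distrl /=.
by apply: eq_bigr => i _; rewrite /c3 -!subnDA addnC mulrA.
Qed.

Lemma ser_cst_mulE (a : S) f k : ser_mul (ser_cst a) f k = a * f k.
Proof.
rewrite /ser_mul big_ord_recl subn0 big1 ?addr0 // => i _.
by rewrite /ser_cst /= mul0r.
Qed.

Lemma ser_mul_cstE (a : S) f k : ser_mul f (ser_cst a) k = f k * a.
Proof.
rewrite ser_mul_rev big_ord_recl subn0 big1 ?addr0 // => i _.
by rewrite /ser_cst /= mulr0.
Qed.

Fact ser_mul1l : left_id (ser_cst (1 : S)) (@ser_mul S).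
Proof. by move=> f; apply: funext => k; rewrite ser_cst_mulE mul1r. Qed.
Fact ser_mul1r : right_id (ser_cst (1 : S)) (@ser_mul S).
Proof. by move=> f; apply: funext => k; rewrite ser_mul_cstE mulr1. Qed.
Fact ser_mulDl : left_distributive (@ser_mul S) (@ser_add S).
Proof.
move=> f g h; apply: funext => k; rewrite /ser_mul /ser_add -big_split /=.
by apply: eq_bigr => i _; rewrite mulrDl.
Qed.
Fact ser_mulDr : right_distributive (@ser_mul S) (@ser_add S).
Proof.
move=> f g h; apply: funext => k; rewrite /ser_mul /ser_add -big_split /=.
by apply: eq_bigr => i _; rewrite mulrDr.
Qed.

HB.instance Definition _ := GRing.Zmodule_isPzRing.Build (ser S)
  ser_mulA ser_mul1l ser_mul1r ser_mulDl ser_mulDr.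

Lemma ser_oneE k : (1 : ser S) k = (k == 0%N)%:R.
Proof. by case: k. Qed.
Lemma ser_mulE f g k : (f * g) k = ser_mul f g k. Proof. by []. Qed.
Lemma ser_addE f g k : (f + g) k = f k + g k. Proof. by []. Qed.
Lemma ser_oppE f k : (- f) k = - f k. Proof. by []. Qed.

Lemma ser_sumE I (r : seq I) (P : pred I) (F : I -> ser S) k :
  (\sum_(i <- r | P i) F i) k = \sum_(i <- r | P i) F i k.
Proof. exact: (big_morph (fun f : ser S => f k)). Qed.

Lemma ser_prodE I (r : seq I) (F : I -> ser S) :
  ser_prod [seq F i | i <- r] = \prod_(i <- r) F i.
Proof. by elim: r => [|i r IH] /=; rewrite ?big_nil // big_cons -IH. Qed.

Fact ser_cst_is_additive : zmod_morphism (@ser_cst S).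
Proof. by move=> a b; apply: funext => -[|k] //=; rewrite ser_addE ser_oppE /= ?subr0. Qed.
Fact ser_cst_is_multiplicative : monoid_morphism (@ser_cst S).
Proof.
split=> // a b; apply: funext => k.
by rewrite [RHS]ser_cst_mulE /ser_cst; case: ifP; rewrite ?mulr0.
Qed.
HB.instance Definition _ := GRing.isZmodMorphism.Build S (ser S) (@ser_cst S)
  ser_cst_is_additive.
HB.instance Definition _ := GRing.isMonoidMorphism.Build S (ser S) (@ser_cst S)
  ser_cst_is_multiplicative.

Definition ser_X : ser S := fun k => (k == 1%N)%:R.

Lemma ser_XmE f k : (ser_X * f) k = if k is k'.+1 then f k' else 0.
Proof.
case: k => [|k]; rewrite ser_mulE /ser_mul.
  by rewrite big_ord_recl big_ord0 /ser_X /= mul0r addr0.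
rewrite 2!big_ord_recl /ser_X /= mul0r add0r mul1r subSS subn0.
by rewrite big1 ?addr0 // => i _; rewrite /= mul0r.
Qed.

Lemma ser_mXE f k : (f * ser_X) k = if k is k'.+1 then f k' else 0.
Proof.
case: k => [|k]; rewrite ser_mulE ser_mul_rev.
  by rewrite big_ord_recl big_ord0 /ser_X /= mulr0 addr0.
rewrite 2!big_ord_recl /ser_X /= mulr0 add0r mulr1 subSS subn0.
by rewrite big1 ?addr0 // => i _; rewrite /= mulr0.
Qed.

Lemma ser_X_comm f : ser_X * f = f * ser_X.
Proof. by apply: funext => k; rewrite ser_XmE ser_mXE. Qed.

Lemma ser_X_inj f g : ser_X * f = ser_X * g -> f = g.
Proof.
by move=> E; apply: funext => k; have := congr1 (@^~ k.+1) E; rewrite /= !ser_XmE.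
Qed.

Lemma ser_linE (c : S) : ser_lin c = 1 + ser_cst c * ser_X.
Proof.
apply: funext => k; rewrite ser_addE ser_mXE /ser_lin.
by case: k => [|[|k]] /=; rewrite ?addr0 ?add0r.
Qed.

Lemma ser_invE (c : S) : ser_inv c = ser_geo c * ser_X.
Proof. by apply: funext => k; rewrite ser_mXE /ser_inv; case: k. Qed.

Lemma ser_lin_geo (c : S) : ser_lin c * ser_geo c = 1.
Proof.
apply: funext => k; rewrite ser_linE mulrDl mul1r -mulrA ser_addE.
rewrite [X in _ + X]ser_cst_mulE ser_XmE /ser_geo.
case: k => [|k]; first by rewrite mulr0 addr0 expr0.
by rewrite exprS mulNr addNr.
Qed.

Lemma ser_geo_lin (c : S) : ser_geo c * ser_lin c = 1.
Proof.
apply: funext => k; rewrite ser_linE mulrDr mulr1 -ser_X_comm mulrA -ser_X_comm -mulrA.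
rewrite ser_addE ser_XmE.
case: k => [|k]; first by rewrite addr0 /ser_geo expr0.
by rewrite [X in _ + X]ser_mul_cstE /ser_geo exprSr mulrN addNr.
Qed.

End SeriesRing.

Section SeriesMap.
Variables (S S' : pzRingType) (phi : S -> S').
Hypotheses (phiD : {morph phi : x y / x + y}) (phi0 : phi 0 = 0)
  (phiM : {morph phi : x y / x * y}) (phi1 : phi 1 = 1).

Definition ser_map (f : ser S) : ser S' := fun k => phi (f k).

Lemma ser_mapM : {morph ser_map : f g / f * g}.
Proof.
move=> f g; apply: funext => k; rewrite /ser_map ser_mulE /ser_mul (big_morph phi phiD phi0); apply: eq_bigr => i _; exact: phiM.
Qed.

Lemma ser_map_cst a : ser_map (ser_cst a) = ser_cst (phi a).
Proof. by apply: funext => -[|k] //; rewrite /ser_map /=. Qed.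

Lemma ser_map1 : ser_map 1 = 1.
Proof. by rewrite ser_map_cst phi1. Qed.

Lemma ser_mapD : {morph ser_map : f g / f + g}.
Proof. by move=> f g; apply: funext => k; apply: phiD. Qed.

Lemma ser_mapX : ser_map (ser_X S) = ser_X S'.
Proof. by apply: funext => -[|[|k]]; rewrite /ser_map /ser_X. Qed.

End SeriesMap.

Section SeriesSubst.
Variables (S : pzRingType) (y : ser S).
Hypotheses (y0 : y 0%N = 0) (yC : forall k a, GRing.comm (y k) a).

Lemma subst_var_comm f : GRing.comm y f.
Proof.
apply: funext => k; rewrite !ser_mulE (ser_mul_rev f) /ser_mul.
by apply: eq_bigr => i _; rewrite (yC _ _).
Qed.

Lemma ser_exp_comm i k a : GRing.comm ((y ^+ i) k) a.
Proof.
elim: i k => [|i IH] k.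
  by rewrite expr0 ser_oneE; apply/commr_sym/commr_nat.
rewrite exprS ser_mulE; apply/commr_sym; apply: commr_sum => j _; apply: commrM; apply/commr_sym.
  exact: yC.
exact: IH.
Qed.

Lemma ser_exp_lt i k : (k < i)%N -> (y ^+ i) k = 0.
Proof.
elim: i k => // i IH k lt_ki; rewrite exprS ser_mulE /ser_mul.
rewrite big1 // => -[[|j] lt_jk] _ /=; first by rewrite y0 mul0r.
by rewrite IH ?mulr0 //=; lia.
Qed.

Definition ser_subst (f : ser S) : ser S :=
  fun m => \sum_(k < m.+1) f k * (y ^+ k) m.

Lemma ser_substE f m M : (m < M)%N ->
  ser_subst f m = \sum_(k < M) f k * (y ^+ k) m.
Proof.
move=> lt_mM; rewrite /ser_subst (big_ord_widen M (fun k => f k * (y ^+ k) m)) //.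
rewrite big_mkcond; apply: eq_bigr => i _; case: ifP => // /negbT.
by rewrite -leqNgt => lt_mi; rewrite ser_exp_lt ?mulr0.
Qed.

Lemma ser_substD : {morph ser_subst : f g / f + g}.
Proof.
move=> f g; apply: funext => m; rewrite ser_addE /ser_subst -big_split /=.
by apply: eq_bigr => k _; rewrite -mulrDl.
Qed.

Lemma ser_subst_cst a : ser_subst (ser_cst a) = ser_cst a.
Proof.
apply: funext => m; rewrite /ser_subst big_ord_recl /= big1 ?addr0; last first.
  by move=> i _; rewrite mul0r.
by rewrite expr0 ser_oneE /ser_cst; case: ifP; rewrite ?mulr1 ?mulr0.
Qed.

Lemma ser_substX : ser_subst (ser_X S) = y.
Proof.
apply: funext => m; rewrite (@ser_substE _ _ m.+2) // 2!big_ord_recl.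
rewrite /ser_X /= mul0r add0r mul1r expr1 big1 ?addr0 // => i _; exact: mul0r.
Qed.

Lemma ser_substM : {morph ser_subst : f g / f * g}.
Proof.
move=> f g; apply: funext => m.
transitivity (\sum_(i < m.+1) \sum_(j < m.+1) f i * g j * (y ^+ (i + j)) m).
  rewrite /ser_subst.
  transitivity (\sum_(k < m.+1) \sum_(i < m.+1 | (i <= k)%N)
      f i * g (k - i)%N * (y ^+ ((k - i) + i)) m).
    apply: eq_bigr => k _; rewrite mulr_suml.
    rewrite (big_ord_widen m.+1 (fun i => f i * g (k - i)%N * (y ^+ k) m)) //.
    by apply: eq_big => [i|i]; rewrite ltnS // => le_ik; rewrite subnK.
  rewrite (exchange_big_dep predT) //=; apply: eq_bigr => i _.
  rewrite [RHS](bigID (fun j : 'I__ => (j <= m - i)%N)) /= [X in _ = _ + X]big1 ?addr0; last first.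
    by move=> j; rewrite -ltnNge => lt; rewrite ser_exp_lt ?mulr0 //; lia.
  rewrite (big_ord_narrow_leq (leq_subr _ _)) /=.
  rewrite -(big_mkord (fun k => (i <= k)%N) (fun k => f i * g (k - i)%N * (y ^+ ((k - i) + i)) m)).
  rewrite (@big_cat_nat _ _ _ i) //=; last by rewrite ltnW.
  rewrite big_nat_cond big1 ?add0r; last by move=> k /andP[/andP[_ lt] le]; lia.
  rewrite -[X in \sum_(X <= _ < _ | _) _](add0n i) big_addn (subSn (leq_ord i)) big_mkord.
  by apply: eq_big => [j|j _]; rewrite ?leq_addl // addnK addnC.
transitivity (\sum_(i < m.+1) \sum_(j < m.+1) \sum_(p < m.+1)
   f i * (y ^+ i) p * (g j * (y ^+ j) (m - p)%N)).
  apply: eq_bigr => i _; apply: eq_bigr => j _.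
  rewrite exprD ser_mulE /ser_mul mulr_sumr; apply: eq_bigr => p _.
  by rewrite -!mulrA; congr (_ * _); rewrite !mulrA; congr (_ * _); rewrite ser_exp_comm.
rewrite [RHS]ser_mulE /ser_mul.
under [RHS]eq_bigr => p _.
  rewrite (@ser_substE _ _ m.+1) ?ltn_ord // (@ser_substE _ (m - p)%N m.+1); last first.
    by rewrite ltnS leq_subr.
  rewrite mulr_suml; under eq_bigr => i _ do rewrite mulr_sumr.
  over.
rewrite /= [RHS]exchange_big; apply: eq_bigr => i _; exact: exchange_big.
Qed.

End SeriesSubst.

(** * Exchange relations *)

Lemma cancel_pos (V : zmodType) (s t : V) : s = - t -> s + t = 0.
Proof. by move->; rewrite addNr. Qed.
Lemma cancel_end (V : zmodType) (s t : V) : s = 0 -> s + t = t.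
Proof. by move->; rewrite add0r. Qed.
Lemma abel_start (V : zmodType) (s t : V) : 0 + (s - t) = 0 -> s = t.
Proof. by rewrite add0r; apply: subr0_eq. Qed.

(* Proves identities between sums of the same atoms in an abelian group. *)
Ltac abel :=
  apply: abel_start; rewrite ?(opprD, opprK, oppr0, addrA, addr0);
  repeat match goal with
  | |- 0 = 0 => reflexivity
  | |- 0 + 0 = 0 => exact: addr0
  | |- ?s + - ?t = 0 => apply: cancel_pos; rewrite ?opprK;
       do 30 (try rewrite (addrAC _ t)); apply: cancel_end
  | |- ?s + ?t = 0 => apply: cancel_pos;
       do 30 (try rewrite (addrAC _ (- t))); apply: cancel_end
  end.

Section RingIdentities.
Variable B : pzRingType.
Implicit Types a b p q x y z P Q : B.

Lemma comm_inv h g z : h * g = 1 -> g * h = 1 -> GRing.comm h z -> GRing.comm g z.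
Proof.
move=> hg gh hz; rewrite /GRing.comm.
by rewrite -[LHS]mulr1 -hg mulrA -(mulrA g z h) -hz mulrA gh mul1r.
Qed.

Lemma commutator_sub a b s t :
  GRing.comm a b -> GRing.comm a t -> GRing.comm b s ->
  (a - s) * (b - t) - (b - t) * (a - s) = s * t - t * s.
Proof. by move=> ab at_ bs; rewrite !mulrBl !mulrBr ab at_ bs; abel. Qed.

(* Up to normalisation, [p - q * P] is R(u - v) when [p = u - v] and
   [q = lambda]; it is the antisymmetrizer when [p = q = 1]. *)
Lemma yang_baxter P Q1 Q2 a b p q x y :
  P * Q1 = Q2 * P -> P * Q2 = Q1 * P ->
  Q1 * Q2 = Q2 * P -> Q2 * Q1 = Q1 * P ->
  GRing.comm a b -> (forall z, z \in [:: P; Q1; Q2] -> GRing.comm a z) ->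
  (forall z, z \in [:: P; Q1; Q2] -> GRing.comm b z) ->
  central x -> central y -> central p -> central q ->
  p * (x * y) = q * (a * y - b * x) ->
  (p - q * P) * ((a - x * Q1) * (b - y * Q2))
  = ((b - y * Q2) * (a - x * Q1)) * (p - q * P).
Proof.
move=> PQ1 PQ2 Q12 Q21 ab aC bC xC yC pC qC E.
have aP : GRing.comm a P by apply: aC; rewrite !inE eqxx.
have bP : GRing.comm b P by apply: bC; rewrite !inE eqxx.
have aQ1 : GRing.comm a Q1 by apply: aC; rewrite !inE eqxx orbT.
have aQ2 : GRing.comm a Q2 by apply: aC; rewrite !inE eqxx !orbT.
have bQ1 : GRing.comm b Q1 by apply: bC; rewrite !inE eqxx orbT.
set X := a - x * Q1; set Y := b - y * Q2.
pose X' := a - x * Q2; pose Y' := b - y * Q1.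
have PX : P * X = X' * P.
  by rewrite mulrBl mulrBr aP mulrA -(xC P) -!mulrA PQ1.
have PY : P * Y = Y' * P.
  by rewrite mulrBl mulrBr bP mulrA -(yC P) -!mulrA PQ2.
have XY : X * Y - Y * X = x * y * (Q1 * Q2 - Q2 * Q1).
  have axQ : GRing.comm a (y * Q2) by apply: commrM => //; apply/commr_sym.
  have bxQ : GRing.comm b (x * Q1) by apply: commrM => //; apply/commr_sym.
  rewrite commutator_sub //.
  by rewrite mulrBr !mulrA -(mulrA x) -yC -(mulrA y) -xC !mulrA (xC y).
have XY' : X' * Y' - Y * X = (a * y - b * x) * (Q2 - Q1).
  have bQ2 : GRing.comm b Q2 by apply: bC; rewrite !inE eqxx !orbT.
  rewrite !mulrBl !mulrBr ab !mulrA -[x * Q2 * b]mulrA -bQ2 -[y * Q2 * a]mulrA -aQ2 !mulrA.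
  rewrite (xC b) (yC a).
  have -> : y * Q2 * x * Q1 = x * Q2 * y * Q1.
    by rewrite -(mulrA y) -xC (mulrA y) -(mulrA x Q2) -yC mulrA (xC y).
  abel.
have K : Q1 * Q2 - Q2 * Q1 = (Q2 - Q1) * P by rewrite mulrBl Q12 Q21.
have PXY : P * (X * Y) - Y * X * P = (a * y - b * x) * (Q1 * Q2 - Q2 * Q1).
  by rewrite mulrA PX -mulrA PY mulrA -mulrBl XY' -mulrA K.
rewrite mulrBl mulrBr -pC -[q * P * _]mulrA [_ * (q * P)]mulrA -qC -[q * _ * P]mulrA.
apply: subr0_eq.
have -> : forall s t u v : B, s - t - (u - v) = s - u - (t - v).
  by move=> s t u v; abel.
by rewrite -!mulrBr XY PXY (mulrA p) (mulrA q) E subrr.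
Qed.

(* [P * p] is the tensor product of a permutation of the quantum spaces with
   an element of the Hecke algebra. *)
Lemma intertwine P p Q1 Q2 a1 a2 t x Z :
  P * Q1 = Q2 * P -> P * Q2 = Q1 * P -> Q2 * Q1 = Q1 * P -> Q1 * Q2 = Q2 * P ->
  (forall z, z \in [:: P; Q1; Q2] -> GRing.comm p z) ->
  (forall z, z \in [:: P; Q1; Q2; a2] -> GRing.comm a1 z) ->
  (forall z, z \in [:: P; Q1; Q2] -> GRing.comm a2 z) ->
  central x -> central t ->
  p * a1 = a2 * p + t * x -> p * a2 = a1 * p - t * x ->
  P * p * Z = t * Z ->
  P * p * ((a1 - x * Q1) * (a2 - x * Q2) * Z) = t * ((a1 - x * Q1) * (a2 - x * Q2) * Z).
Proof.
move=> PQ1 PQ2 Q21 Q12 pC a1C a2C xC tC pa1 pa2 PZ.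
have [pP pQ1 pQ2] : [/\ GRing.comm p P, GRing.comm p Q1 & GRing.comm p Q2].
  by split; apply: pC; rewrite !inE eqxx ?orbT.
have [a1P a1Q1 a1Q2 a12] :
  [/\ GRing.comm a1 P, GRing.comm a1 Q1, GRing.comm a1 Q2 & GRing.comm a1 a2].
  by split; apply: a1C; rewrite !inE eqxx ?orbT.
have [a2P a2Q1 a2Q2] : [/\ GRing.comm a2 P, GRing.comm a2 Q1 & GRing.comm a2 Q2].
  by split; apply: a2C; rewrite !inE eqxx ?orbT.
pose s1 := x * Q1; pose s2 := x * Q2; pose c := t * x.
have cC : central c by move=> z; apply/commr_sym/commrM; apply/commr_sym.
have Ps1 : P * s1 = s2 * P by rewrite mulrA -(xC P) -mulrA PQ1 mulrA.
have Ps2 : P * s2 = s1 * P by rewrite mulrA -(xC P) -mulrA PQ2 mulrA.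
have ps1 : p * s1 = s1 * p by apply: commrM => //; apply/commr_sym.
have ps2 : p * s2 = s2 * p by apply: commrM => //; apply/commr_sym.
have s21 : s2 * s1 = x * s1 * P by rewrite /s2 /s1 -!mulrA (mulrA Q2) -(xC Q2) -mulrA Q21.
have s12 : s1 * s2 = x * s2 * P by rewrite /s2 /s1 -!mulrA (mulrA Q1) -(xC Q1) -mulrA Q12.
rewrite -/s1 -/s2; set N1 := a1 - s1; set N2 := a2 - s2.
have PN1 : P * p * N1 = N2 * (P * p) + c * P.
  rewrite -mulrA mulrBr pa1 ps1 mulrBr mulrDr (mulrA P a2) -a2P (mulrA P s1) Ps1 -(cC P).
  by rewrite mulrBl !mulrA; abel.
have PN2 : P * p * N2 = N1 * (P * p) - c * P.
  rewrite -mulrA mulrBr pa2 ps2 !mulrBr (mulrA P a1) -a1P (mulrA P s2) Ps2 -(cC P).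
  by rewrite mulrBl !mulrA; abel.
have PN2' : P * N2 = N2 * P + (s2 - s1) * P.
  by rewrite mulrBr -a2P Ps2 !mulrBl; abel.
have N21 : N2 * N1 = N1 * N2 + x * (s1 - s2) * P.
  have a2s1 : GRing.comm a2 s1 by apply: commrM => //; apply/commr_sym.
  have a1s2 : GRing.comm a1 s2 by apply: commrM => //; apply/commr_sym.
  have a21 : GRing.comm a2 a1 by apply/commr_sym.
  apply: subr0_eq; rewrite opprD addrA commutator_sub //.
  by rewrite s21 s12 mulrBr mulrBl; abel.
have NN : P * p * (N1 * N2) =
    N1 * N2 * (P * p) + (x * (s1 - s2) * P * (P * p) - c * (s1 - s2) * P).
  rewrite mulrA PN1 mulrDl -(mulrA N2) PN2 -(mulrA c) PN2' mulrBr mulrDr.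
  rewrite (mulrA N2 N1) N21 mulrDl (mulrA N2 c) -(cC N2) !mulrA mulrBr mulrBl.
  by rewrite -(opprB s1 s2) mulrN mulNr; abel.
have K0 : (x * (s1 - s2) * P * (P * p) - c * (s1 - s2) * P) * Z = 0.
  by rewrite mulrBl -(mulrA _ (P * p) Z) PZ (mulrA _ t Z) -tC /c !mulrA subrr.
by rewrite [LHS]mulrA NN mulrDl K0 addr0 -(mulrA _ (P * p)) PZ mulrA -tC -!mulrA.
Qed.

Lemma exchange_prod (I : eqType) (s : seq I) (f g : I -> B) r :
  uniq s -> {in s, forall i, r * (f i * g i) = g i * f i * r} ->
  {in s &, forall i j, i != j -> GRing.comm (f i) (g j)} ->
  r * ((\prod_(i <- s) f i) * (\prod_(i <- s) g i))
  = (\prod_(i <- s) g i) * (\prod_(i <- s) f i) * r.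
Proof.
elim: s => [|i s IH] /=; first by rewrite !big_nil !mulr1 mul1r.
case/andP=> i_s us rfg fg; rewrite !big_cons.
set F := \prod_(j <- s) f j; set G := \prod_(j <- s) g j.
have rFG : r * (F * G) = G * F * r.
  apply: IH => // [j js|j k js ks]; first by apply: rfg; rewrite inE js orbT.
  by apply: fg; rewrite inE ?js ?ks orbT.
have Fg : GRing.comm (g i) F.
  rewrite /F big_seq; apply: commr_prod => j js.
  apply/commr_sym/fg; rewrite ?inE ?js ?eqxx ?orbT //.
  by apply: contraNneq i_s => <-.
have fG : GRing.comm (f i) G.
  rewrite /G big_seq; apply: commr_prod => j js.
  apply/fg; rewrite ?inE ?js ?eqxx ?orbT //.
  by apply: contraNneq i_s => ->.
have -> : f i * F * (g i * G) = f i * g i * (F * G).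
  by rewrite -!mulrA; congr (_ * _); rewrite !mulrA Fg.
rewrite mulrA rfg ?inE ?eqxx // -mulrA rFG -!mulrA; congr (_ * _).
by rewrite !mulrA fG.
Qed.
End RingIdentities.

(** * The symmetrizer of a Coxeter system of type A *)

Section Symmetrizer.
Variables (B : pzRingType) (N : nat) (s : nat -> B).

Definition coxeter_rel :=
  [/\ forall i, (1 <= i)%N -> (i.+1 < N)%N -> s i * s i.+1 * s i = s i.+1 * s i * s i.+1,
      forall i j, (1 <= i)%N -> (i.+1 < j)%N -> (j < N)%N -> s i * s j = s j * s i &
      forall i, (1 <= i)%N -> (i < N)%N -> s i * s i = 1].

Lemma Pcal_succ i : Pcal s i i.+1 = s i.
Proof. by rewrite /Pcal /= big_geq // /index_iota subnn big_nil mul1r mulr1. Qed.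

Lemma Pcal_rec i j : (i.+1 < j)%N -> Pcal s i j = s i * Pcal s i.+1 j * s i.
Proof.
case: j => // j; rewrite ltnS => lt_ij; rewrite /Pcal /= big_ltn //.
have -> : index_iota i j = i :: index_iota i.+1 j.
  by rewrite /index_iota -(subnSK lt_ij).
by rewrite rev_cons -cats1 big_cat big_seq1 /= !mulrA.
Qed.

Lemma Pcal_ind (P : nat -> B -> Prop) j :
  (forall i, j = i.+1 -> P i (s i)) ->
  (forall i X, (i.+1 < j)%N -> P i.+1 X -> P i (s i * X * s i)) ->
  forall i, (i < j)%N -> P i (Pcal s i j).
Proof.
move=> P1 PS i; move e: (j - i)%N => n; elim: n i e => [|n IH] i e lt_ij; first lia.
have [lt|le] := ltnP i.+1 j; first by rewrite Pcal_rec //; apply/PS/IH => //; lia.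
have -> : j = i.+1 by lia.
by rewrite Pcal_succ; apply: P1; lia.
Qed.

Lemma Pcal_fix (X : B) i j : (i < j)%N ->
  (forall k, (i <= k)%N -> (k < j)%N -> s k * X = X) -> Pcal s i j * X = X.
Proof.
move=> lt_ij.
pose P i (Y : B) := (forall k, (i <= k)%N -> (k < j)%N -> s k * X = X) -> Y * X = X.
apply: (@Pcal_ind P) => // {lt_ij}i => [ij fix_|Y lt_ij IH fix_].
  by rewrite fix_ //; lia.
by rewrite -!mulrA fix_ ?IH ?fix_ //; try lia; move=> k *; apply: fix_; lia.
Qed.

Lemma Pcal_comm (X : B) i j : (i < j)%N ->
  (forall k, (i <= k)%N -> (k < j)%N -> GRing.comm X (s k)) -> GRing.comm X (Pcal s i j).
Proof.
move=> lt_ij.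
pose P i (Y : B) := (forall k, (i <= k)%N -> (k < j)%N -> GRing.comm X (s k)) -> GRing.comm X Y.
apply: (@Pcal_ind P) => // {lt_ij}i => [ij com|Y lt_ij IH com].
  by apply: com; lia.
by apply: commrM; [apply: commrM|]; try apply: com; try apply: IH => // *; try apply: com; lia.
Qed.

Hypothesis cox : coxeter_rel.
Let braid : forall i, (1 <= i)%N -> (i.+1 < N)%N ->
  s i * s i.+1 * s i = s i.+1 * s i * s i.+1. Proof. by case: cox. Qed.
Let far : forall i j, (1 <= i)%N -> (i.+1 < j)%N -> (j < N)%N ->
  s i * s j = s j * s i. Proof. by case: cox. Qed.
Let sq : forall i, (1 <= i)%N -> (i < N)%N -> s i * s i = 1. Proof. by case: cox. Qed.

Lemma Pcal_sq i j : (1 <= i)%N -> (i < j)%N -> (j <= N)%N -> Pcal s i j * Pcal s i j = 1.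
Proof.
move=> i1 lt_ij lejN; move: i lt_ij i1.
apply: (@Pcal_ind (fun i Y => (1 <= i)%N -> Y * Y = 1)) => i => [|Y] lt IH => [|i1].
  by apply: sq; lia.
rewrite -!mulrA (mulrA (s i) (s i)) sq ?mul1r; [|lia..].
by rewrite (mulrA Y) IH // mul1r sq //; lia.
Qed.

Lemma Pcal_mid k j i : (1 <= i)%N -> (i < k)%N -> (k.+1 < j)%N -> (j <= N)%N ->
  GRing.comm (s k) (Pcal s i j).
Proof.
move=> i1 lt_ik lt_kj le_jN; move e: (k - i)%N => n; elim: n i i1 e lt_ik => [|n IH] i i1 e lt_ik.
  lia.
have [->|lt] := eqVneq k i.+1; last first.
  rewrite Pcal_rec; last lia.
  have c : GRing.comm (s k) (s i) by apply/commr_sym/far; lia.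
  by apply: commrM => //; apply: commrM => //; apply: IH; lia.
have c : GRing.comm (s i) (Pcal s i.+2 j).
  by apply: Pcal_comm => [|l le_l lt_l]; first lia; apply: far; lia.
rewrite Pcal_rec 1?Pcal_rec; try lia.
move: (Pcal s i.+2 j) c => t c.
rewrite /GRing.comm !mulrA -braid; try lia.
rewrite -(mulrA (s i * s i.+1) (s i)) c.
by rewrite -!mulrA; do 3 congr (_ * _); rewrite !mulrA braid //; lia.
Qed.

Lemma Pcal_swap1 i j : (1 <= i)%N -> (i.+1 < j)%N -> (j <= N)%N ->
  s i * Pcal s i.+1 j = Pcal s i j * s i.
Proof. by move=> i1 lt le; rewrite (Pcal_rec lt); move: (Pcal _ _ _) => t; rewrite -!mulrA sq ?mulr1 //; lia. Qed.

Lemma Pcal_swap2 i j : (1 <= i)%N -> (i.+1 < j)%N -> (j <= N)%N ->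
  s i * Pcal s i j = Pcal s i.+1 j * s i.
Proof. by move=> i1 lt le; rewrite (Pcal_rec lt); move: (Pcal _ _ _) => t; rewrite !mulrA sq ?mul1r //; lia. Qed.

Lemma Pcal_conj i m : (1 <= i)%N -> (i < m)%N -> (m < N)%N ->
  Pcal s i m.+1 * s m * Pcal s i m.+1 = Pcal s i m.
Proof.
move=> i1 lt_im lt_mN; move e: (m - i)%N => n; elim: n i i1 e lt_im => [|n IH] i i1 e lt_im.
  lia.
rewrite (@Pcal_rec i m.+1) //.
have [lt|le] := ltnP i.+1 m; last first.
  have -> : m = i.+1 by lia.
  rewrite !Pcal_succ braid; [|lia..].
  rewrite -!mulrA (mulrA (s i.+1) (s i.+1)) sq ?mul1r; try lia.
  rewrite !mulrA -braid -?mulrA; try lia.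
  by rewrite (mulrA (s i) (s i)) !sq ?mul1r ?sq ?mulr1 //; lia.
rewrite (@Pcal_rec i m) // -IH; try lia.
move: (Pcal s i.+1 m.+1) => t; rewrite -!mulrA; do 2 congr (_ * _).
by rewrite !mulrA -(mulrA (s i) (s m)) -far 1?mulrA ?sq ?mul1r; try lia.
Qed.

Definition jucys j := \sum_(0 <= i < j) Pcal s i.+1 j.+1.
Definition sym_sum m := \prod_(1 <= j < m) (1 + jucys j).

Lemma jucys_comm m k : (m < N)%N -> (1 <= k)%N -> (k < m)%N ->
  GRing.comm (s k) (jucys m).
Proof.
case: k => // k lt_mN _ lt_km; rewrite /jucys.
have split_sum : \sum_(0 <= i < m) Pcal s i.+1 m.+1 =
    \sum_(0 <= i < k) Pcal s i.+1 m.+1 + (Pcal s k.+1 m.+1 + Pcal s k.+2 m.+1)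
    + \sum_(k.+2 <= i < m) Pcal s i.+1 m.+1.
  rewrite (@big_cat_nat _ _ _ k) //=; last lia.
  rewrite -addrA; congr (_ + _).
  by rewrite big_ltn; [rewrite big_ltn; [rewrite addrA|lia]|lia].
rewrite split_sum; apply: commrD; first apply: commrD.
- rewrite big_nat; apply: commr_sum => i /andP[_ lt]; apply: Pcal_mid; lia.
- by rewrite /GRing.comm mulrDr mulrDl Pcal_swap2 ?Pcal_swap1 1?addrC //; lia.
rewrite big_nat; apply: commr_sum => i /andP[le lt].
by apply: Pcal_comm => [|l le_l lt_l]; first lia; apply: far; lia.
Qed.

Lemma sym_sum_comm m : (m < N)%N -> GRing.comm (sym_sum m) (jucys m).
Proof.
move=> lt_mN; apply/commr_sym; rewrite [sym_sum m]big_nat.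
apply: commr_prod => j /andP[j1 lt_jm]; apply: commrD; first exact: commr1.
rewrite [jucys j]big_nat; apply: commr_sum => i /andP[_ lt].
apply: Pcal_comm => [|l le_l lt_l]; first lia.
by apply/commr_sym/jucys_comm; lia.
Qed.

Lemma sym_sum_fix m k : (m <= N)%N -> (1 <= k)%N -> (k < m)%N ->
  s k * sym_sum m = sym_sum m.
Proof.
elim: m k => // m IH k lt_mN k1; rewrite ltnS => le_km.
have m1 : (1 <= m)%N by lia.
have SE : sym_sum m.+1 = sym_sum m * (1 + jucys m) by rewrite /sym_sum big_nat_recr.
have [lt_km|le_mk] := ltnP k m; first by rewrite SE mulrA IH //; lia.
have {le_mk le_km} -> : k = m by lia.
have -> : sym_sum m.+1 = (1 + jucys m) * sym_sum m.
  by rewrite SE mulrDr mulrDl mulr1 mul1r sym_sum_comm.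
have -> : 1 + jucys m = 1 + s m + \sum_(0 <= i < m.-1) Pcal s i.+1 m.+1.
  by case: (m) m1 => // m' _; rewrite [jucys _]big_nat_recr //= Pcal_succ addrA addrAC.
rewrite mulrA mulrDr mulrDr mulr1 sq // (addrC (s m)) [LHS]mulrDl [RHS]mulrDl.
congr (_ + _); rewrite mulr_sumr !mulr_suml !big_nat; apply: eq_bigr => i /andP[_ lt].
set T := Pcal s i.+1 m.+1.
have TT : T * T = 1 by apply: Pcal_sq; lia.
have -> : s m * T = T * Pcal s i.+1 m.
  rewrite -(@Pcal_conj i.+1 m); try lia. 
  by rewrite -/T; move: (T) TT => u uu; rewrite !mulrA uu mul1r.
by rewrite -mulrA Pcal_fix //; [lia|move=> l *; apply: IH; lia].
Qed.

Lemma sym_sum_absorb m X :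
  (forall k, (1 <= k)%N -> (k < m)%N -> s k * X = X) ->
  sym_sum m * X = X *+ m`!.
Proof.
elim: m => [|m IH] fixX.
  by rewrite /sym_sum big_geq // mul1r.
have [->|m1] := posnP m; first by rewrite /sym_sum big_geq // mul1r.
rewrite /sym_sum big_nat_recr //= -mulrA mulrDl mul1r.
have -> : jucys m * X = X *+ m.
  rewrite /jucys mulr_suml big_nat (eq_bigr (fun _ => X)).
    by rewrite -big_nat sumr_const_nat subn0.
  by move=> i /andP[_ lt]; apply: Pcal_fix => [|k *]; [lia|apply: fixX; lia].
rewrite -mulrS mulrnAr.
have -> : \prod_(1 <= j < m) (1 + jucys j) * X = X *+ m`!.
  by apply: IH => k *; apply: fixX; lia.
by rewrite -mulrnA factS mulnC.
Qed.
End Symmetrizer.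

(** * Operators on tensor powers *)

Section Operators.
Variables (A : pzRingType) (n : nat).

Definition ent M (X : op A n M) (x y : idx n M) : A := X (enum_rank x) (enum_rank y).

Definition pm M M' (f : 'I_M' -> 'I_M) (x : idx n M) : idx n M' := [ffun p => x (f p)].

Definition posop M (f : 'I_M -> 'I_M) : op A n M :=
  \matrix_(x, y) (eidx x == pm f (eidx y))%:R.

Lemma pm_comp M M' M'' (f : 'I_M' -> 'I_M) (g : 'I_M'' -> 'I_M') x :
  pm g (pm f x) = pm (f \o g) x.
Proof. by apply/ffunP => p; rewrite !ffunE. Qed.

Lemma op_ext M (X Y : op A n M) : (forall x y, ent X x y = ent Y x y) -> X = Y.
Proof.
move=> E; apply/matrixP => i j.
by have := E (enum_val i) (enum_val j); rewrite /ent !enum_valK.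
Qed.

Lemma entM M (X Y : op A n M) x z :
  ent (X * Y) x z = \sum_y ent X x y * ent Y y z.
Proof.
rewrite /ent [LHS]mxE (reindex (@enum_rank (idx n M))) //.
exact/onW_bij/enum_rank_bij.
Qed.

Lemma entD M (X Y : op A n M) x y : ent (X + Y) x y = ent X x y + ent Y x y.
Proof. by rewrite /ent mxE. Qed.

Lemma ent_scalar M (a : A) x y : ent (asop n M a) x y = a *+ (x == y).
Proof. by rewrite /ent mxE (inj_eq enum_rank_inj). Qed.

Lemma ent_posop M (f : 'I_M -> 'I_M) x y : ent (posop f) x y = (x == pm f y)%:R.
Proof. by rewrite /ent mxE /eidx !enum_rankK. Qed.

Lemma PmxE M a b : Pmx A n a b = posop (tperm a b : 'I_M -> 'I_M).
Proof. by []. Qed.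

Lemma ent_mul_posop M (f : 'I_M -> 'I_M) X x z :
  ent (X * posop f) x z = ent X x (pm f z).
Proof.
rewrite entM (bigD1 (pm f z)) //= ent_posop eqxx mulr1 big1 ?addr0 // => y /negbTE ne.
by rewrite ent_posop ne mulr0.
Qed.

Lemma ent_posop_mul M (f g : 'I_M -> 'I_M) X x z : cancel g f -> cancel f g ->
  ent (posop f * X) (pm f x) z = ent X x z.
Proof.
move=> gf fg; have inj : injective (@pm M M f).
  by apply: (can_inj (g := pm g)) => u; rewrite pm_comp; apply/ffunP => p; rewrite ffunE /= gf.
rewrite entM (bigD1 x) //= ent_posop eqxx mul1r big1 ?addr0 // => y ne.
by rewrite ent_posop (inj_eq inj) eq_sym (negbTE ne) mul0r.
Qed.

Lemma posopM M (f g : 'I_M -> 'I_M) : posop f * posop g = posop (g \o f).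
Proof. by apply: op_ext => x z; rewrite ent_mul_posop !ent_posop pm_comp. Qed.

Lemma eq_posop M (f g : 'I_M -> 'I_M) : f =1 g -> posop f = posop g.
Proof.
move=> E; apply: op_ext => x z; rewrite !ent_posop; congr (_ == _)%:R.
by apply/ffunP => p; rewrite !ffunE E.
Qed.

Lemma posop_id M : posop (@id 'I_M) = 1.
Proof.
apply: op_ext => x z; rewrite ent_posop (ent_scalar 1); congr (_ == _)%:R.
by apply/ffunP => p; rewrite !ffunE.
Qed.

Lemma asopM M (a b : A) : asop n M (a * b) = asop n M a * asop n M b.
Proof. exact: (scalar_mxM _ a b). Qed.
Lemma asopD M (a b : A) : asop n M (a + b) = asop n M a + asop n M b.
Proof. exact: raddfD. Qed.
Lemma asopN M (a : A) : asop n M (- a) = - asop n M a.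
Proof. exact: raddfN. Qed.

Lemma asop_comm M (a : A) (X : op A n M) :
  (forall x y, GRing.comm a (ent X x y)) -> GRing.comm (asop n M a) X.
Proof.
move=> aX; apply: op_ext => x z; rewrite !entM (bigD1 x) //= [RHS](bigD1 z) //=.
rewrite !ent_scalar !eqxx !mulr1n (aX x z); congr (_ + _).
rewrite !big1 // => y /negbTE ne; rewrite ent_scalar ?ne ?mulr0 //.
by rewrite eq_sym ne mul0r.
Qed.

Lemma asop_posop M (a : A) (f : 'I_M -> 'I_M) : GRing.comm (asop n M a) (posop f).
Proof. by apply: asop_comm => x y; rewrite ent_posop; apply: commr_nat. Qed.

Section Embedding.
Variables (M M' : nat) (s : 'I_M -> 'I_M').
Hypothesis s_inj : injective s.

Definition off (x y : idx n M') := [forall p, (p \notin codom s) ==> (x p == y p)].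

Lemma ent_emb X x y : ent (emb s X) x y = ent X (pm s x) (pm s y) * (off x y)%:R.
Proof. by rewrite /ent mxE /eidx !enum_rankK. Qed.

Lemma off_eq x y : off x y -> (pm s x == pm s y) = (x == y).
Proof.
move=> /forallP xy; apply/eqP/eqP => [E|-> //]; apply/ffunP => p.
have [/codomP[q ->]|np] := boolP (p \in codom s).
  by have := congr1 (fun z : idx n M => z q) E; rewrite !ffunE.
by have := xy p; rewrite np => /eqP.
Qed.

Lemma off_refl x : off x x.
Proof. by apply/forallP => p; apply/implyP. Qed.

Lemma off_trans y x z : off x y -> off x z = off y z.
Proof.
move=> /forallP xy; apply: eq_forallb => p.
by case: (boolP (p \in codom s)) => //= np; have := xy p; rewrite np => /eqP ->.
Qed.

Definition glue (x : idx n M') (y : idx n M) : idx n M' :=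
  [ffun p => if [pick q | s q == p] is Some q then y q else x p].

Lemma pm_glue x y : pm s (glue x y) = y.
Proof.
apply/ffunP => q; rewrite !ffunE; case: pickP => [q' /eqP/s_inj -> //|/(_ q)].
by rewrite eqxx.
Qed.

Lemma off_glue x y : off x (glue x y).
Proof.
apply/forallP => p; apply/implyP => np; rewrite ffunE; case: pickP => // q /eqP E.
by rewrite -E codom_f in np.
Qed.

Lemma embM : {morph @emb A n M M' s : X Y / X * Y}.
Proof.
move=> X Y; apply: op_ext => x z; rewrite ent_emb !entM mulr_suml.
rewrite [RHS](bigID (off x)) /= [X in _ = _ + X]big1 ?addr0; last first.
  by move=> y /negbTE ne; rewrite ent_emb ne mulr0 mul0r.
rewrite [RHS](reindex_onto (glue x) (pm s)) /=; last first.
  move=> y xy; apply/eqP; rewrite -off_eq ?pm_glue //.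
  by rewrite -(off_trans _ (off_glue x (pm s y))).
apply: eq_big => [y|y _]; first by rewrite pm_glue off_glue eqxx.
by rewrite !ent_emb pm_glue off_glue mulr1 (off_trans _ (off_glue x y)) mulrA.
Qed.

Lemma embD : {morph @emb A n M M' s : X Y / X + Y}.
Proof.
by move=> X Y; apply: op_ext => x z; rewrite !entD !ent_emb entD mulrDl.
Qed.

Lemma emb_asop (a : A) : emb s (asop n M a) = asop n M' a.
Proof.
apply: op_ext => x z; rewrite ent_emb !ent_scalar.
have [xz|nxz] := boolP (off x z); first by rewrite off_eq // mulr1.
rewrite mulr0; have [xz|//] := eqVneq x z.
by rewrite xz off_refl in nxz.
Qed.

Lemma emb0 : emb s (0 : op A n M) = 0.
Proof. by apply: (addrI (emb s 0)); rewrite -embD !addr0. Qed.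

Lemma emb1 : emb s (1 : op A n M) = 1.
Proof. exact: (emb_asop 1). Qed.

Lemma emb_Pmx a b : emb s (Pmx A n a b) = Pmx A n (s a) (s b).
Proof.
apply: op_ext => x z; rewrite ent_emb !PmxE !ent_posop -natrM mulnb; congr _%:R.
congr (nat_of_bool _); apply/andP/eqP => [[/eqP E /forallP xz]|->]; last first.
  split; first by apply/eqP/ffunP => p; rewrite !ffunE -inj_tperm.
  apply/forallP => p; apply/implyP => np; rewrite ffunE tpermD //.
    by apply: contraNneq np => <-; apply: codom_f.
  by apply: contraNneq np => <-; apply: codom_f.
apply/ffunP => p; rewrite ffunE.
have [/codomP[q ->]|np] := boolP (p \in codom s).
  by have := congr1 (fun z : idx n M => z q) E; rewrite !ffunE -inj_tperm.
rewrite tpermD; first by have := xz p; rewrite np => /eqP.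
  by apply: contraNneq np => <-; apply: codom_f.
by apply: contraNneq np => <-; apply: codom_f.
Qed.
End Embedding.

End Operators.

(* [L = (u + D - l Q) / (u + D - l)], written in terms of [x = u^-1]. *)
Definition lax_op (B : pzRingType) (L D Q l x : B) :=
  exists2 g, L = (1 + D * x - l * x * Q) * g &
    (1 + (D - l) * x) * g = 1 /\ g * (1 + (D - l) * x) = 1.

Lemma lax_op_morph (B B' : pzRingType) (phi : B -> B') (L D Q l x : B) :
  {morph phi : a b / a + b} -> {morph phi : a b / a * b} -> phi 1 = 1 ->
  lax_op L D Q l x -> lax_op (phi L) (phi D) (phi Q) (phi l) (phi x).
Proof.
move=> phiD phiM phi1 [g -> [hg gh]].
have phi0 : phi 0 = 0 by apply: (addrI (phi 0)); rewrite -phiD !addr0.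
have phiN a : phi (- a) = - phi a by apply: (addrI (phi a)); rewrite -phiD !subrr.
exists (phi g); first by rewrite phiM !phiD phiN !phiM phi1.
by rewrite -phiN -phiD -phiM -phi1 -phiD -!phiM hg gh.
Qed.

Section LaxOperators.
Variable B : pzRingType.
Implicit Types D L Q l p q x y z P : B.

Lemma comm_central x z : central x -> GRing.comm z x.
Proof. by move=> c; apply/commr_sym/c. Qed.

Lemma comm_affine D x z : central x -> GRing.comm z D -> GRing.comm z (1 + D * x).
Proof.
move=> xC zD; apply: commrD; first exact: commr1.
by apply: commrM => //; apply: comm_central.
Qed.

Lemma lax_op_comm L D Q l x z : lax_op L D Q l x -> central l -> central x ->
  GRing.comm D z -> GRing.comm Q z -> GRing.comm L z.
Proof.
move=> [g -> [hg gh]] lC xC /commr_sym zD /commr_sym zQ; apply/commr_sym.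
apply: commrM.
  apply: commrB; first exact: comm_affine.
  by apply: commrM => //; apply: commrM; apply: comm_central.
apply/commr_sym/(comm_inv hg gh)/commr_sym/comm_affine => //.
by apply: commrB => //; apply: comm_central.
Qed.

Lemma lax_op_rtt L1 L2 D P Q1 Q2 l p q x y :
  lax_op L1 D Q1 l x -> lax_op L2 D Q2 l y ->
  P * Q1 = Q2 * P -> P * Q2 = Q1 * P ->
  Q1 * Q2 = Q2 * P -> Q2 * Q1 = Q1 * P ->
  (forall z, z \in [:: P; Q1; Q2] -> GRing.comm D z) ->
  central l -> central x -> central y -> central p -> central q ->
  p * (l * x * (l * y)) = q * (l * (y - x)) ->
  (p - q * P) * (L1 * L2) = L2 * L1 * (p - q * P).
Proof.
move=> [g1 -> [hg1 gh1]] [g2 -> [hg2 gh2]] PQ1 PQ2 Q12 Q21 DC lC xC yC pC qC E.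
have lxC : central (l * x) by move=> z; apply/commr_sym/commrM; apply: comm_central.
have lyC : central (l * y) by move=> z; apply/commr_sym/commrM; apply: comm_central.
have aC z x' : central x' -> GRing.comm D z -> GRing.comm (1 + D * x') z.
  by move=> c /commr_sym Dz; apply/commr_sym/comm_affine.
have DD x' : central x' -> GRing.comm D (1 + D * x') by move=> c; apply: comm_affine.
have ab : GRing.comm (1 + D * x) (1 + D * y) by apply: aC => //; apply: DD.
have gC z h g x' : h = 1 + (D - l) * x' -> central x' -> h * g = 1 -> g * h = 1 ->
    GRing.comm D z -> GRing.comm g z.
  move=> -> c hg gh /commr_sym Dz; apply: (comm_inv hg gh); apply/commr_sym/comm_affine => //.
  by apply: commrB => //; apply: comm_central.
have g1C z : GRing.comm D z -> GRing.comm g1 z by apply: (gC z _ _ x erefl).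
have g2C z : GRing.comm D z -> GRing.comm g2 z by apply: (gC z _ _ y erefl).
have DN x' Q : central x' -> Q \in [:: P; Q1; Q2] -> GRing.comm D (1 + D * x' - l * x' * Q).
  move=> c /DC DQ; apply: commrB; first exact: DD.
  by apply: commrM => //; apply: commrM; apply: comm_central.
have YB := @yang_baxter B P Q1 Q2 (1 + D * x) (1 + D * y) p q (l * x) (l * y).
set N1 := 1 + D * x - l * x * Q1; set N2 := 1 + D * y - l * y * Q2.
have g1N2 : GRing.comm g1 N2 by apply/g1C/DN; rewrite // !inE eqxx !orbT.
have g2N1 : GRing.comm g2 N1 by apply/g2C/DN; rewrite // !inE eqxx !orbT.
have DR : GRing.comm D (p - q * P).
  apply: commrB; first exact: comm_central.
  by apply: commrM; [apply: comm_central|apply: DC; rewrite inE eqxx].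
have gg : GRing.comm g1 g2 by apply/g1C/commr_sym/g2C.
have -> : N1 * g1 * (N2 * g2) = N1 * N2 * (g1 * g2).
  by rewrite -!mulrA; congr (_ * _); rewrite !mulrA g1N2.
have -> : N2 * g2 * (N1 * g1) = N2 * N1 * (g1 * g2).
  by rewrite gg -!mulrA; congr (_ * _); rewrite !mulrA g2N1.
rewrite mulrA YB //; first last.
- rewrite E; congr (_ * _); rewrite mulrBr !mulrDl !mul1r.
  have -> : D * x * (l * y) = D * y * (l * x).
    by rewrite -!mulrA; congr (_ * _); rewrite mulrA -(lC x) -!mulrA (xC y) mulrA lC -mulrA.
  by abel.
- by move=> z zP; apply: aC => //; apply: DC.
- by move=> z zP; apply: aC => //; apply: DC.
have Rgg : GRing.comm (p - q * P) (g1 * g2).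
  by apply: commrM; apply/commr_sym; [apply: g1C|apply: g2C].
by rewrite -/N1 -/N2 -(mulrA (N2 * N1)) Rgg mulrA.
Qed.

Lemma lax_op_intertwine L1 L2 D1 D2 P p Q1 Q2 t l x Z :
  lax_op L1 D1 Q1 l x -> lax_op L2 D2 Q2 l x ->
  P * Q1 = Q2 * P -> P * Q2 = Q1 * P -> Q2 * Q1 = Q1 * P -> Q1 * Q2 = Q2 * P ->
  (forall z, z \in [:: P; Q1; Q2] -> GRing.comm p z) ->
  (forall z, z \in [:: P; Q1; Q2; D2] -> GRing.comm D1 z) ->
  (forall z, z \in [:: P; Q1; Q2] -> GRing.comm D2 z) ->
  central l -> central x -> central t ->
  p * D1 = D2 * p + t * l -> p * D2 = D1 * p - t * l ->
  P * p * Z = t * Z ->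
  P * p * (L1 * L2 * Z) = t * (L1 * L2 * Z).
Proof.
move=> [g1 -> [hg1 gh1]] [g2 -> [hg2 gh2]] PQ1 PQ2 Q21 Q12 pC D1C D2C lC xC tC pD1 pD2 PZ.
have lxC : central (l * x) by move=> z; apply/commr_sym/commrM; apply: comm_central.
set h1 := 1 + (D1 - l) * x in hg1 gh1; set h2 := 1 + (D2 - l) * x in hg2 gh2.
have D12 : GRing.comm D1 D2 by apply: D1C; rewrite !inE eqxx !orbT.
have h1C z : GRing.comm D1 z -> GRing.comm h1 z.
  move=> Dz; apply/commr_sym/comm_affine => //.
  by apply: commrB; [apply/commr_sym|apply: comm_central].
have h2C z : GRing.comm D2 z -> GRing.comm h2 z.
  move=> Dz; apply/commr_sym/comm_affine => //.
  by apply: commrB; [apply/commr_sym|apply: comm_central].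
have g1C z : GRing.comm D1 z -> GRing.comm g1 z by move=> Dz; apply: (comm_inv hg1 gh1); apply: h1C.
have g2C z : GRing.comm D2 z -> GRing.comm g2 z by move=> Dz; apply: (comm_inv hg2 gh2); apply: h2C.
have hp D : (1 + (D - l) * x) * p = p + (D * p - l * p) * x.
  by rewrite mulrDl mul1r -mulrA (xC p) mulrA mulrBl.
have ph1 : p * h1 = h2 * p + t * l * x.
  by rewrite hp /h1 mulrDr mulr1 mulrA mulrBr pD1 -(lC p) !mulrBl mulrDl; abel.
have ph2 : p * h2 = h1 * p - t * l * x.
  by rewrite hp /h2 mulrDr mulr1 mulrA mulrBr pD2 -(lC p) !mulrBl; abel.
have phh : GRing.comm p (h1 * h2).
  rewrite /GRing.comm mulrA ph1 mulrDl -mulrA ph2 mulrBr !mulrA.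
  have -> : h2 * t * l * x = t * l * x * h2 by rewrite -(tC h2) -!mulrA; congr (t * _); rewrite mulrA -(lC h2) -!mulrA (xC h2).
  by rewrite subrK (h1C h2) //; apply/commr_sym/h2C/commr_sym.
have h12 : GRing.comm h1 h2 by apply/h1C/commr_sym/h2C/commr_sym.
have pgg : GRing.comm p (g1 * g2).
  have g1h2 : GRing.comm g1 h2 by apply: (comm_inv hg1 gh1).
  apply/commr_sym/(@comm_inv _ (h1 * h2)); last exact/commr_sym.
  - by rewrite h12 -mulrA (mulrA h1) hg1 mul1r.
  - by rewrite h12 -mulrA (mulrA g2) gh2 mul1r.
have D1x z : GRing.comm D1 z -> GRing.comm (1 + D1 * x) z.
  by move=> /commr_sym Dz; apply/commr_sym/comm_affine.
have D2x z : GRing.comm D2 z -> GRing.comm (1 + D2 * x) z.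
  by move=> /commr_sym Dz; apply/commr_sym/comm_affine.
set N1 := 1 + D1 * x - l * x * Q1; set N2 := 1 + D2 * x - l * x * Q2.
have g1N2 : GRing.comm g1 N2.
  apply/g1C/commrB; first by apply: comm_affine.
  by apply: commrM; [apply: comm_central|apply: D1C; rewrite !inE eqxx !orbT].
have -> : N1 * g1 * (N2 * g2) * Z = N1 * N2 * (g1 * g2 * Z).
  by rewrite [RHS]mulrA; congr (_ * Z); rewrite -!mulrA; congr (_ * _); rewrite !mulrA g1N2.
apply: intertwine => //.
- move=> z; rewrite !inE => zP; apply: D1x.
  case/or4P: zP => /eqP->; [..|by apply: comm_affine];
    by apply: D1C; rewrite !inE eqxx ?orbT.
- by move=> z zP; apply/D2x/D2C.
- by rewrite mulrDr mulr1 mulrA pD1 !mulrDl mul1r -(mulrA _ x) (xC p) !mulrA addrA.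
- by rewrite mulrDr mulr1 mulrA pD2 mulrBl mulrDl mul1r -(mulrA _ x) (xC p) !mulrA addrA.
have Pgg : GRing.comm P (g1 * g2).
  apply: commrM; apply/commr_sym.
    by apply: g1C; apply: D1C; rewrite !inE eqxx.
  by apply: g2C; apply: D2C; rewrite !inE eqxx.
have Ppgg : GRing.comm (P * p) (g1 * g2).
  by apply/commr_sym/commrM; apply/commr_sym.
by rewrite mulrA Ppgg -mulrA PZ mulrA -(tC (g1 * g2)) -mulrA.
Qed.
End LaxOperators.

Lemma ser_cst_central (S : pzRingType) (c : S) : central c -> central (ser_cst c).
Proof.
by move=> cC f; apply: funext => k; rewrite !ser_mulE ser_cst_mulE ser_mul_cstE cC.
Qed.

Lemma ser_X_central (S : pzRingType) : central (ser_X S).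
Proof. exact: ser_X_comm. Qed.

Lemma ser_cst_comm (S : pzRingType) (a b : S) :
  GRing.comm a b -> GRing.comm (ser_cst a) (ser_cst b).
Proof. by move=> ab; rewrite /GRing.comm -!rmorphM ab. Qed.

Section Tperm.
Variable T : finType.
Implicit Types a b c d x : T.

Lemma tperm_conj a b c d x :
  tperm c d (tperm a b x) = tperm a b (tperm (tperm a b c) (tperm a b d) x).
Proof. by rewrite [RHS](inj_tperm _ _ _ (@perm_inj _ (tperm a b))) !tpermK. Qed.

Lemma tperm_off a b x : x != a -> x != b -> tperm a b x = x.
Proof. by move=> xa xb; rewrite tpermD // eq_sym. Qed.

Lemma tperm_comm a b c d x : c != a -> c != b -> d != a -> d != b ->
  tperm c d (tperm a b x) = tperm a b (tperm c d x).
Proof. by move=> ca cb da db; rewrite tperm_conj (tperm_off ca cb) (tperm_off da db). Qed.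

Lemma tperm_through a b c x : c != a -> c != b ->
  tperm a b (tperm b c (tperm a b x)) = tperm a c x.
Proof. by move=> ca cb; rewrite (tperm_conj a b b c) tpermK tpermR (tperm_off ca cb). Qed.

End Tperm.

Section Permutations.
Variables (A : pzRingType) (n M : nat).
Implicit Types a b c d : 'I_M.
Local Notation P := (@Pmx A n M).

Lemma Pmx_sym a b : P a b = P b a.
Proof. by rewrite !PmxE; apply: eq_posop => p; rewrite tpermC. Qed.

Lemma Pmx_conj a b c d : P a b * P c d = P (tperm a b c) (tperm a b d) * P a b.
Proof. by rewrite !PmxE !posopM; apply: eq_posop => p; apply: tperm_conj. Qed.

Lemma Pmx_comm a b c d : c != a -> c != b -> d != a -> d != b ->
  GRing.comm (P a b) (P c d).
Proof.
by move=> ca cb da db; rewrite /GRing.comm Pmx_conj (tperm_off ca cb) (tperm_off da db).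
Qed.

Lemma Pmx_triple a b c : a != b -> c != a -> c != b ->
  [/\ P a b * P c a = P c b * P a b, P a b * P c b = P c a * P a b,
      P c a * P c b = P c b * P a b & P c b * P c a = P c a * P a b].
Proof.
move=> ab ca cb.
have [bc ac] : b != c /\ a != c by rewrite ![_ == c]eq_sym.
have ba : b != a by rewrite eq_sym.
have E1 : P a b * P c a = P c b * P a b by rewrite Pmx_conj tpermL (tperm_off ca cb).
have E2 : P a b * P c b = P c a * P a b by rewrite Pmx_conj tpermR (tperm_off ca cb).
split=> //.
  by rewrite Pmx_conj tpermL (tperm_off bc ba) E1.
by rewrite Pmx_conj tpermL (tperm_off ac ab) (Pmx_sym b a) E2.
Qed.
End Permutations.

Section Scalars.
Variables (C : fieldType) (A : algType C) (n M : nat).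
Local Notation S := (op A n M).
Local Notation cs := (@cs C A n M).

Lemma csE c : cs c = asop n M c%:A. Proof. by []. Qed.
Lemma csM a b : cs (a * b) = cs a * cs b.
Proof. by rewrite !csE -asopM -scalerAl mul1r scalerA. Qed.
Lemma csD a b : cs (a + b) = cs a + cs b.
Proof. by rewrite !csE -asopD scalerDl. Qed.
Lemma cs1 : cs 1 = 1. Proof. by rewrite csE scale1r. Qed.
Lemma cs0 : cs 0 = 0. Proof. by rewrite csE scale0r; apply: raddf0. Qed.
Lemma cs_nat k : cs k%:R = k%:R.
Proof. by elim: k => [|k IH]; rewrite ?cs0 // !mulrS csD cs1 IH. Qed.

Lemma cs_central c : central (cs c).
Proof.
move=> X; apply: asop_comm => x y.
by rewrite /GRing.comm mulr_algl mulr_algr.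
Qed.
End Scalars.

Section LaxSeries.
Variables (C : fieldType) (A : algType C) (n M : nat).
Local Notation S := (op A n M).

Lemma Lser_lax (lam : C) (a b : 'I_M) (di : A) :
  lax_op (Lser n lam a b di) (ser_cst (asop n M di)) (ser_cst (Pmx A n a b))
    (ser_cst (cs A n M lam)) (ser_X S).
Proof.
set D := asop n M di; set l := cs A n M lam; set Q := Pmx A n a b.
have DQ : GRing.comm D Q by apply: asop_posop.
have lin c : ser_lin c = 1 + ser_cst c * ser_X S :> ser S by apply: ser_linE.
exists (ser_geo (D - l)); last first.
  by rewrite -rmorphB -lin ser_lin_geo ser_geo_lin.
have -> : Lser n lam a b di =
  ser_lin D * ser_geo (D - l) * (1 - ser_cst (l * Q) * (ser_geo D * ser_X S)).
  by rewrite -ser_invE.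
have -> : 1 + ser_cst D * ser_X S = ser_lin D by rewrite lin.
have cX z : GRing.comm z (ser_X S) by apply: comm_central; apply: ser_X_central.
have cl z : GRing.comm z (ser_cst l).
  by apply: comm_central; apply/ser_cst_central/cs_central.
have linC (c : S) z : GRing.comm z (ser_cst c) -> GRing.comm z (ser_lin c).
  by move=> zc; rewrite lin; apply: comm_affine => //; apply: ser_X_central.
have geoC (c : S) z : GRing.comm z (ser_cst c) -> GRing.comm z (ser_geo c).
  move=> zc; apply/commr_sym/(comm_inv (ser_lin_geo c) (ser_geo_lin c)).
  exact/commr_sym/linC.
have gD : GRing.comm (ser_geo (D - l)) (ser_cst D).
  by apply/commr_sym/geoC; rewrite rmorphB; apply: commrB.
have gQ : GRing.comm (ser_geo (D - l)) (ser_cst Q).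
  apply/commr_sym/geoC; rewrite rmorphB; apply: commrB => //.
  exact/commr_sym/ser_cst_comm.
have g1 : GRing.comm (ser_geo (D - l)) (1 - ser_cst (l * Q) * (ser_geo D * ser_X S)).
  apply: commrB; first exact: commr1.
  rewrite rmorphM; apply: commrM; first exact: commrM.
  by apply: commrM => //; apply: geoC.
rewrite -mulrA g1 mulrA; congr (_ * _).
rewrite mulrBr mulr1; congr (_ - _).
have linQ : GRing.comm (ser_lin D) (ser_cst (l * Q)).
  apply/commr_sym/linC; rewrite rmorphM; apply/commr_sym/commrM => //.
  exact: ser_cst_comm.
by rewrite mulrA linQ -!mulrA (mulrA (ser_lin D)) ser_lin_geo mul1r rmorphM -!mulrA cX.
Qed.

End LaxSeries.

(** * Quantum spaces *)

Section Tensor.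
Variables (C : fieldType) (A : algType C) (n M : nat).

Definition tensor_el (t : C) (f : 'I_M -> 'I_M) (a : A) : op A n M :=
  cs A n M t * (posop A n f * asop n M a).

Lemma tensor_elM t u f g a b :
  tensor_el t f a * tensor_el u g b = tensor_el (t * u) (g \o f) (a * b).
Proof.
rewrite /tensor_el csM asopM -posopM -!mulrA; congr (_ * _).
rewrite !mulrA -(cs_central u) -!mulrA; congr (_ * (_ * _)).
by rewrite !mulrA asop_posop.
Qed.

Lemma PmxE_tensor t a b x :
  tensor_el t (tperm a b) x = cs A n M t * (Pmx A n a b * asop n M x).
Proof. by rewrite PmxE. Qed.

Lemma eq_tensor_el t u f g a b : t = u -> f =1 g -> a = b ->
  tensor_el t f a = tensor_el u g b.
Proof. by move=> -> /(eq_posop A n) fg ->; rewrite /tensor_el fg. Qed.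

Lemma tensor_el1 : tensor_el 1 id 1 = 1.
Proof. by rewrite /tensor_el cs1 posop_id !mul1r. Qed.

End Tensor.

Section QuantumSpaces.
Variables (C : numFieldType) (A : algType C) (n M N : nat) (lam tau : C).
Variables (d Pg : nat -> A) (q : nat -> 'I_M) (qp : 'I_N -> 'I_M).
Hypotheses (tau2 : tau * tau = 1) (rel : dAHA_rel N (tau * lam) d Pg).
Hypotheses (qE : forall i : 'I_N, qp i = q i).
Hypothesis (q_inj : forall i j, (i < N)%N -> (j < N)%N -> q i = q j -> i = j).

Lemma q_neq i j : (i < N)%N -> (j < N)%N -> i != j -> q i != q j.
Proof. by move=> iN jN; apply: contra => /eqP/q_inj->. Qed.

(* [Pg k] exchanges the spaces [k] and [k + 1], whose 0-based labels are
   [k - 1] and [k]. *)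
Definition signed_swap k : op A n M :=
  tensor_el n tau (tperm (q k.-1) (q k)) (Pg k).

Lemma signed_swap_cox : coxeter_rel N signed_swap.
Proof.
have [braid [far [sq _]]] := rel; split.
- move=> i i1 iN; rewrite /signed_swap !tensor_elM; apply: eq_tensor_el => //=; last first.
    by apply: braid => //; lia.
  have [ab [ac bc]] : q i.-1 != q i /\ q i.-1 != q i.+1 /\ q i != q i.+1.
    by do !split; apply: q_neq; lia.
  move=> p; rewrite /= tperm_through 1?[q i.+1 == _]eq_sym //.
  by rewrite (tpermC _ (q i)) (tpermC (q i) (q i.+1)) tperm_through // tpermC.
- move=> i j i1 ij jN; rewrite /signed_swap !tensor_elM; apply: eq_tensor_el => //=; last first.
    by apply: far => //; lia.
  by move=> p; rewrite /= tperm_comm //; apply: q_neq; lia.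
move=> i i1 iN; rewrite /signed_swap !tensor_elM -(tensor_el1 A n M).
by apply: eq_tensor_el => [//|p /=|]; [exact: tpermK|apply: sq; lia].
Qed.

Lemma signed_swap_Pcal i j : (i < j)%N -> (j < N)%N ->
  Pcal signed_swap i.+1 j.+1 = tensor_el n tau (tperm (q i) (q j)) (Pcal Pg i.+1 j.+1).
Proof.
move=> + jN; move e: (j - i)%N => m; elim: m i e => [|m IH] i e ij; first lia.
have [lt|le] := ltnP i.+1 j; last first.
  by have -> : j = i.+1 by [lia]; rewrite !Pcal_succ.
rewrite !(@Pcal_rec _ _ i.+1) ?ltnS // IH; try lia.
rewrite /signed_swap !tensor_elM; apply: eq_tensor_el => [|p|] //=.
  by rewrite tau2 mul1r.
by rewrite tperm_through //; apply: q_neq; lia.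
Qed.

Lemma Lambda1E :
  Lambda1 n qp tau Pg = cs A n M (N`!%:R)^-1 * sym_sum signed_swap N.
Proof.
rewrite /Lambda1; congr (_ * _).
transitivity (\prod_(j < N | (1 <= j)%N) (1 + jucys signed_swap j)).
  apply: eq_bigr => j _; congr (_ + _).
  rewrite mulr_sumr /jucys big_mkord
    (big_ord_widen N (fun i => Pcal signed_swap i.+1 j.+1)) ?(ltnW (ltn_ord j)) //=.
  apply: eq_bigr => i ij; rewrite !qE -PmxE_tensor.
  by rewrite signed_swap_Pcal.
rewrite -(big_mkord (fun j => (1 <= j)%N) (fun j => 1 + jucys signed_swap j)).
rewrite /sym_sum big_nat_cond [RHS]big_nat_cond.
have [->|N1] := posnP N; first by rewrite !big_geq.
rewrite big_ltn_cond //=. rewrite andbF; apply: eq_bigl => j.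
by rewrite andbT andbC.
Qed.

Lemma signed_swap_Lambda1 k : (1 <= k)%N -> (k < N)%N ->
  signed_swap k * Lambda1 n qp tau Pg = Lambda1 n qp tau Pg.
Proof.
move=> k1 kN; rewrite Lambda1E mulrA -cs_central -mulrA (sym_sum_fix signed_swap_cox) //.
Qed.

Lemma Lambda1_absorb X : (forall k, (1 <= k)%N -> (k < N)%N -> signed_swap k * X = X) ->
  Lambda1 n qp tau Pg * X = X.
Proof.
move=> fixX; rewrite Lambda1E -mulrA sym_sum_absorb // -(mulr_natl X) mulrA.
by rewrite -(cs_nat A n M) -csM mulVf ?cs1 ?mul1r // pnatr_eq0 -lt0n fact_gt0.
Qed.

Lemma Tser_fix (a : 'I_M) k : (forall i, (i < N)%N -> a != q i) -> (1 <= k)%N -> (k < N)%N ->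
  ser_cst (signed_swap k) * (Tser n qp lam a d * ser_cst (Lambda1 n qp tau Pg))
  = Tser n qp lam a d * ser_cst (Lambda1 n qp tau Pg).
Proof.
move=> aq k1 kN; set La := Lambda1 _ _ _ _.
pose L i := Lser n lam a (q i) (d i.+1).
have TE : Tser n qp lam a d = \prod_(0 <= i < N) L i.
  rewrite /Tser ser_prodE /index_iota subn0 -val_enum_ord big_map.
  by apply: eq_bigr => i _; rewrite /L qE.
pose f1 := \prod_(0 <= i < k.-1) L i; pose f2 := \prod_(k.+1 <= i < N) L i.
have {}TE : Tser n qp lam a d = f1 * (L k.-1 * L k * f2).
  rewrite TE (@big_cat_nat _ _ _ k.-1) //=; last lia.
  by congr (_ * _); rewrite big_ltn ?(prednK k1); [rewrite big_ltn // mulrA|lia].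
have [_ [_ [_ [Pd [Pd1 [Pd2 dd]]]]]] := rel.
pose x := ser_X (op A n M); pose l := ser_cst (cs A n M lam).
have xC : central x by apply: ser_X_central.
have lC : central l by apply/ser_cst_central/cs_central.
have tC : central (ser_cst (cs A n M tau)) by apply/ser_cst_central/cs_central.
pose P := ser_cst (Pmx A n (q k.-1) (q k)); pose p := ser_cst (asop n M (Pg k)).
have sE : ser_cst (signed_swap k) = ser_cst (cs A n M tau) * (P * p).
  by rewrite /signed_swap PmxE_tensor !rmorphM.
have sL i : (i < N)%N -> i != k.-1 -> i != k -> GRing.comm (ser_cst (signed_swap k)) (L i).
  move=> iN ik1 ik; apply/commr_sym/(lax_op_comm (Lser_lax _ _ _ _ _)) => //; rewrite sE.
    apply: commrM; first exact: comm_central.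
    apply: commrM; first by apply/ser_cst_comm/asop_posop.
    apply: ser_cst_comm; rewrite /GRing.comm -!asopM Pd //; lia.
  apply: commrM; first exact: comm_central.
  apply: commrM; last by apply/ser_cst_comm/commr_sym/asop_posop.
  by apply/ser_cst_comm/commr_sym/Pmx_comm; rewrite ?aq // ?q_neq //; lia.
have sf1 : GRing.comm (ser_cst (signed_swap k)) f1.
  by rewrite /f1 big_nat; apply: commr_prod => i /andP[_ lt]; apply: sL; lia.
have sf2 : GRing.comm (ser_cst (signed_swap k)) f2.
  by rewrite /f2 big_nat; apply: commr_prod => i /andP[? ?]; apply: sL; lia.
set Z := f2 * ser_cst La.
have sZ : ser_cst (signed_swap k) * Z = Z.
  by rewrite /Z mulrA sf2 -mulrA -rmorphM signed_swap_Lambda1.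
have tt z : ser_cst (cs A n M tau) * (ser_cst (cs A n M tau) * z) = z.
  by rewrite mulrA -rmorphM -csM tau2 cs1 rmorph1 mul1r.
have PZ : P * p * Z = ser_cst (cs A n M tau) * Z.
  by rewrite -(tt (P * p * Z)) (mulrA _ (P * p)) -sE sZ.
have -> : Tser n qp lam a d * ser_cst La = f1 * (L k.-1 * L k * Z).
  by rewrite TE -!mulrA.
rewrite (mulrA _ f1) sf1 -(mulrA f1); congr (_ * _). rewrite sE -(mulrA _ (P * p)).
have qk : q k.-1 != q k by apply: q_neq; lia.
have [ak1 ak] : a != q k.-1 /\ a != q k by split; apply: aq; lia.
have [R1 R2 R3 R4] := Pmx_triple A n qk ak1 ak.
have cst_comm (X Y : op A n M) : GRing.comm X Y -> GRing.comm (ser_cst X) (ser_cst Y).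
  exact: ser_cst_comm.
have asopPmx e b c : GRing.comm (ser_cst (asop n M e)) (ser_cst (Pmx A n b c)).
  by apply/cst_comm/asop_posop.
have k1' : k.-1.+1 = k by lia.
rewrite (@lax_op_intertwine _ (L k.-1) (L k) (ser_cst (asop n M (d k)))
  (ser_cst (asop n M (d k.+1))) P p (ser_cst (Pmx A n a (q k.-1)))
  (ser_cst (Pmx A n a (q k))) (ser_cst (cs A n M tau)) l x Z) ?tt //.
- by rewrite /L k1'; apply: Lser_lax.
- exact: Lser_lax.
- by rewrite /P -!rmorphM R1.
- by rewrite /P -!rmorphM R2.
- by rewrite /P -!rmorphM R4.
- by rewrite /P -!rmorphM R3.
- by move=> z; rewrite !inE => /or3P[] /eqP->; apply: asopPmx.
- move=> z; rewrite !inE => /or4P[] /eqP->; try exact: asopPmx.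
  by apply: cst_comm; rewrite /GRing.comm -!asopM dd //; lia.
- by move=> z; rewrite !inE => /or3P[] /eqP->; apply: asopPmx.
- have E : asop n M (Pg k) * asop n M (d k) =
      asop n M (d k.+1) * asop n M (Pg k) + cs A n M tau * cs A n M lam.
    by rewrite -csM -!asopM csE Pd1 ?asopD //; lia.
  by rewrite -[LHS]rmorphM E rmorphD !(rmorphM (@ser_cst (op A n M))).
have E : asop n M (Pg k) * asop n M (d k.+1) =
    asop n M (d k) * asop n M (Pg k) - cs A n M tau * cs A n M lam.
  by rewrite -csM -!asopM csE Pd2 ?asopD ?asopN //; lia.
by rewrite -[LHS]rmorphM E rmorphB !(rmorphM (@ser_cst (op A n M))).
Qed.

Lemma Lambda1_Tser (a : 'I_M) m : (forall i, (i < N)%N -> a != q i) ->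
  Lambda1 n qp tau Pg * (Tser n qp lam a d m * Lambda1 n qp tau Pg)
  = Tser n qp lam a d m * Lambda1 n qp tau Pg.
Proof.
move=> aq; apply: Lambda1_absorb => k k1 kN.
have /(congr1 (fun f : ser (op A n M) => f m)) := Tser_fix aq k1 kN.
by rewrite ser_mulE ser_cst_mulE ser_mulE ser_mul_cstE.
Qed.

End QuantumSpaces.

(** * The RTT relation *)

Section Bivariate.
Variable S : pzRingType.
Implicit Types (f g : ser S) (F G : ser (ser S)).

Lemma bser_mulE F G : bser_mul F G = F * G.
Proof.
apply: funext => k; apply: funext => l.
by rewrite ser_mulE /ser_mul ser_sumE.
Qed.

Lemma in_uE f : in_u f = ser_map (@ser_cst S) f. Proof. by []. Qed.

Lemma in_vE f : in_v f = ser_cst f.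
Proof. by apply: funext => k; apply: funext => l; rewrite /in_v /ser_cst; case: ifP. Qed.

Definition in_uD := @ser_mapD _ _ _ (raddfD (@ser_cst S)).
Definition in_uM :=
  @ser_mapM _ _ _ (raddfD (@ser_cst S)) (raddf0 (@ser_cst S)) (rmorphM (@ser_cst S)).
Definition in_u1 := @ser_map1 _ _ _ (raddf0 (@ser_cst S)) (rmorph1 (@ser_cst S)).
Definition in_u_cst a : ser_map (@ser_cst S) (ser_cst a) = ser_cst (ser_cst a) :=
  @ser_map_cst _ _ _ (raddf0 (@ser_cst S)) a.
Definition in_uX : ser_map (@ser_cst S) (ser_X S) = ser_X (ser S) :=
  @ser_mapX _ _ _ (raddf0 (@ser_cst S)) (rmorph1 (@ser_cst S)).
End Bivariate.

Section RTT.
Variables (C : fieldType) (A : algType C) (n M N : nat) (lam : C).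
Variables (d : nat -> A) (q : 'I_N -> 'I_M) (a a' : 'I_M).
Hypotheses (q_inj : injective q) (aa' : a != a').
Hypotheses (aq : forall i, a != q i) (aq' : forall i, a' != q i).
Hypothesis dd : forall i j, (1 <= i <= N)%N -> (1 <= j <= N)%N -> d i * d j = d j * d i.
Local Notation S := (op A n M).
Local Notation cc c := (ser_cst (ser_cst (c : S))).

Lemma Rnorm_series :
  Rnorm A n lam a a' = ser_cst (ser_X S) - ser_X (ser S)
    - cc (cs A n M lam) * ser_X (ser S) * ser_cst (ser_X S) * cc (Pmx A n a a').
Proof.
have XC : central (ser_X (ser S)) by apply: ser_X_central.
have xC : central (ser_cst (ser_X S)) by apply/ser_cst_central/ser_X_central.
have -> : cc (cs A n M lam) * ser_X (ser S) * ser_cst (ser_X S) * cc (Pmx A n a a') =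
    cc (cs A n M lam * Pmx A n a a') * (ser_X (ser S) * ser_cst (ser_X S)).
  by rewrite -mulrA (xC (cc _)) -mulrA (mulrA (ser_X (ser S))) (XC (cc _)) !mulrA -!rmorphM.
have ccM (b : S) (F : ser (ser S)) k l : (cc b * F) k l = b * F k l.
  rewrite [(cc b * F) k](_ : _ = ser_cst b * F k); last exact: ser_cst_mulE.
  exact: ser_cst_mulE.
apply: funext => k; apply: funext => l.
rewrite !ser_addE !ser_oppE ccM ser_XmE.
rewrite /Rnorm /ser_cst /ser_X.
case: k => [|[|k]]; case: l => [|[|l]] //=;
  by rewrite ?mulr0 ?mulr1 ?subr0 ?oppr0 ?addr0 ?add0r ?sub0r.
Qed.

Lemma RTT (r : ser (ser S)) : r = Rnorm A n lam a a' ->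
  r * (ser_map (@ser_cst S) (Tser n q lam a d) * ser_cst (Tser n q lam a' d)) =
  ser_cst (Tser n q lam a' d) * ser_map (@ser_cst S) (Tser n q lam a d) * r.
Proof.
move=> ->; rewrite Rnorm_series /Tser !ser_prodE (big_morph _ (@in_uM S) (@in_u1 S)) rmorph_prod.
pose l := cc (cs A n M lam); pose P := cc (Pmx A n a a').
pose x := ser_X (ser S); pose y := ser_cst (ser_X S).
have lC : central l by apply/ser_cst_central/ser_cst_central/cs_central.
have xC : central x by apply: ser_X_central.
have yC : central y by apply/ser_cst_central/ser_X_central.
have uL b i : lax_op (ser_map (@ser_cst S) (Lser n lam b (q i) (d i.+1)))
    (cc (asop n M (d i.+1))) (cc (Pmx A n b (q i))) l x.
  have := lax_op_morph (@in_uD S) (@in_uM S) (@in_u1 S) (Lser_lax n lam b (q i) (d i.+1)).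
  by rewrite !in_u_cst in_uX.
have vL b i : lax_op (ser_cst (Lser n lam b (q i) (d i.+1)))
    (cc (asop n M (d i.+1))) (cc (Pmx A n b (q i))) l y.
  exact: lax_op_morph (raddfD _) (rmorphM _) (rmorph1 _) (Lser_lax n lam b (q i) (d i.+1)).
have ccC (X Y : S) : GRing.comm X Y -> GRing.comm (cc X) (cc Y).
  by move=> XY; apply/ser_cst_comm/ser_cst_comm.
have DP e b c : GRing.comm (cc (asop n M e)) (cc (Pmx A n b c)) by apply/ccC/asop_posop.
have qa i : q i != a by rewrite eq_sym.
have qa' i : q i != a' by rewrite eq_sym.
apply: exchange_prod; first exact: enum_uniq.
- move=> i _; rewrite -/l -/P -/x -/y.
  have [R1 R2 R3 R4] := Pmx_triple A n aa' (qa i) (qa' i).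
  rewrite !(Pmx_sym A n (q i)) in R1 R2 R3 R4.
  apply: (lax_op_rtt (uL a i) (vL a' i)).
  - by rewrite /P -!rmorphM R1.
  - by rewrite /P -!rmorphM R2.
  - by rewrite /P -!rmorphM R3.
  - by rewrite /P -!rmorphM R4.
  - by move=> z; rewrite !inE => /or3P[] /eqP->; apply: DP.
  - by [].
  - by [].
  - by [].
  - by move=> z; apply/commr_sym/commrB; apply: comm_central.
  - by move=> z; apply/commr_sym/commrM; [apply: commrM|]; apply: comm_central.
  have pC : central (y - x) by move=> z; apply/commr_sym/commrB; apply: comm_central.
  by rewrite pC [RHS]mulrA; congr (_ * _); rewrite -!mulrA (lC y).
move=> i j _ _ ij; apply: (lax_op_comm (uL a i)) => //.
  apply/commr_sym/(lax_op_comm (vL a' j)) => //.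
    by apply: ccC; rewrite /GRing.comm -!asopM dd ?ltn_ord.
  exact/commr_sym/DP.
apply/commr_sym/(lax_op_comm (vL a' j)) => //.
apply/ccC/Pmx_comm; rewrite // ?(inj_eq q_inj) //; by rewrite eq_sym.
Qed.
End RTT.

Section RTTLambda.
Variables (C : numFieldType) (A : algType C) (n M N : nat) (lam tau : C).
Variables (d Pg : nat -> A) (q : nat -> 'I_M) (qp : 'I_N -> 'I_M) (a a' : 'I_M).
Hypotheses (tau2 : tau * tau = 1) (rel : dAHA_rel N (tau * lam) d Pg).
Hypotheses (qE : forall i : 'I_N, qp i = q i) (qp_inj : injective qp) (aa' : a != a').
Hypotheses (aq : forall i, a != qp i) (aq' : forall i, a' != qp i).
Local Notation S := (op A n M).
Local Notation La := (Lambda1 n qp tau Pg).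

Lemma q_inj_on i j : (i < N)%N -> (j < N)%N -> q i = q j -> i = j.
Proof.
move=> iN jN; have := qE (Ordinal iN); have := qE (Ordinal jN) => /= <- <-.
by move/qp_inj/(congr1 val).
Qed.

Lemma q_off b i : (forall i, b != qp i) -> (i < N)%N -> b != q i.
Proof. by move=> bq iN; have := bq (Ordinal iN); rewrite qE. Qed.

Lemma Lambda1_Pmx : GRing.comm (Pmx A n a a') La.
Proof.
rewrite /Lambda1; apply: commrM; first exact/comm_central/cs_central.
apply: commr_prod => j _; apply: commrD; first exact: commr1.
apply: commrM; first exact/comm_central/cs_central.
apply: commr_sum => i _; apply: commrM; last exact/commr_sym/asop_posop.
by apply: Pmx_comm; rewrite eq_sym.
Qed.

Lemma RTT_Lambda1 :
  let TL := ser_mul (Tser n qp lam a d) (ser_cst La) in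
  let T'L := ser_mul (Tser n qp lam a' d) (ser_cst La) in
  bser_mul (Rnorm A n lam a a') (bser_mul (in_u TL) (in_v T'L))
  = bser_mul (bser_mul (in_v T'L) (in_u TL)) (Rnorm A n lam a a').
Proof.
move=> TL T'L; rewrite !bser_mulE in_uE in_vE.
set T := Tser n qp lam a d in TL *; set T' := Tser n qp lam a' d in T'L *.
pose La2 : ser (ser S) := ser_cst (ser_cst La).
pose U : ser (ser S) := ser_map (@ser_cst S) T; pose V : ser (ser S) := ser_cst T'.
pose r : ser (ser S) := Rnorm A n lam a a'.
have fixT b : (forall i, b != qp i) ->
    ser_cst La * (Tser n qp lam b d * ser_cst La) = Tser n qp lam b d * ser_cst La.
  move=> bq; apply: funext => m; rewrite ser_mulE ser_cst_mulE ser_mulE ser_mul_cstE.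
  apply: (@Lambda1_Tser C A n M N lam tau d Pg q qp tau2 rel qE q_inj_on b m) => i iN; exact: q_off.
have UL : ser_map (@ser_cst S) TL = U * La2 by rewrite [LHS]in_uM in_u_cst.
have VL : ser_cst T'L = V * La2 by rewrite [LHS]rmorphM.
have fixU : La2 * (U * La2) = U * La2.
  by rewrite /La2 -in_u_cst -!in_uM fixT.
have fixV : La2 * (V * La2) = V * La2.
  by rewrite /La2 /V -!(rmorphM (@ser_cst (ser S))) fixT.
have rLa : GRing.comm r La2.
  rewrite /r Rnorm_series; apply/commr_sym/commrB; first apply: commrB.
  - exact/comm_central/ser_cst_central/ser_X_central.
  - exact/comm_central/ser_X_central.
  apply: commrM; last by apply/ser_cst_comm/ser_cst_comm/commr_sym/Lambda1_Pmx.
  apply: commrM; last exact/comm_central/ser_cst_central/ser_X_central.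
  apply: commrM; last exact/comm_central/ser_X_central.
  exact/comm_central/ser_cst_central/ser_cst_central/cs_central.
have dd i j : (1 <= i <= N)%N -> (1 <= j <= N)%N -> d i * d j = d j * d i.
  by case: rel => _ [_ [_ [_ [_ [_ dd]]]]] /andP[? ?] /andP[? ?]; apply: dd.
have rtt : r * (U * V) = V * U * r by apply: RTT.
rewrite UL VL -/r.
have -> : U * La2 * (V * La2) = U * V * La2 by rewrite -mulrA fixV mulrA.
have -> : V * La2 * (U * La2) = V * U * La2 by rewrite -mulrA fixU mulrA.
by rewrite mulrA rtt -(mulrA _ r) rLa mulrA.
Qed.
End RTTLambda.

(** * Antisymmetrization *)

Section Antisymmetrizer.
Variables (C : numFieldType) (A : algType C) (n N : nat).
Local Notation S := (op A n (n + N)).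
Local Notation lsh := (@lshift n N).
Local Notation rsh := (@rshift n N).

Lemma eq_opp_eq0 (V : lmodType C) (v : V) : v = - v -> v = 0.
Proof.
move=> /eqP; rewrite -addr_eq0 -mulr2n -scaler_nat scaler_eq0 pnatr_eq0 /=.
by move/eqP.
Qed.

Definition aux_perm (s : 'S_n) (p : 'I_(n + N)) : 'I_(n + N) :=
  match split p with inl i => lsh (s i) | inr j => rsh j end.

Lemma aux_perm_l s i : aux_perm s (lsh i) = lsh (s i).
Proof. by rewrite /aux_perm; have := unsplitK (inl i : 'I_n + 'I_N) => /= ->. Qed.

Lemma aux_perm_r s j : aux_perm s (rsh j) = rsh j.
Proof. by rewrite /aux_perm; have := unsplitK (inr j : 'I_n + 'I_N) => /= ->. Qed.

Lemma split_ind (P : 'I_(n + N) -> Prop) :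
  (forall i, P (lsh i)) -> (forall j, P (rsh j)) -> forall p, P p.
Proof. by move=> Pl Pr p; rewrite -(splitK p); case: (split p) => /=. Qed.

Lemma aux_permM s t p : aux_perm (s * t)%g p = aux_perm t (aux_perm s p).
Proof.
by elim/split_ind: p => i; rewrite ?aux_perm_l ?aux_perm_r ?permM.
Qed.

Lemma aux_perm1 p : aux_perm 1%g p = p.
Proof. by elim/split_ind: p => i; rewrite ?aux_perm_l ?aux_perm_r ?perm1. Qed.

Lemma aux_perm_tperm i j p : aux_perm (tperm i j) p = tperm (lsh i) (lsh j) p.
Proof.
elim/split_ind: p => k; rewrite ?aux_perm_l ?aux_perm_r.
  by rewrite (inj_tperm _ _ _ (@lshift_inj n N)).
by rewrite tpermD // eq_sym eq_rlshift.
Qed.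

Lemma PpermE (s : 'S_n) : Pperm A N s = posop A n (aux_perm s).
Proof.
apply/matrixP => x y; rewrite !mxE; congr (nat_of_bool _)%:R.
apply/forallP/eqP => [E|-> p]; last by rewrite ffunE.
by apply/ffunP => p; rewrite ffunE; apply/eqP/E.
Qed.

Lemma PpermM (s t : 'S_n) : Pperm A N s * Pperm A N t = Pperm A N (s * t)%g.
Proof. by rewrite !PpermE posopM; apply: eq_posop => p; rewrite aux_permM. Qed.

Lemma Pperm_tperm i j : Pperm A N (tperm i j) = Pmx A n (lsh i) (lsh j).
Proof. by rewrite PpermE PmxE; apply: eq_posop => p; apply: aux_perm_tperm. Qed.

Lemma antisym_mulr i j : i != j -> antisym A n N * Pmx A n (lsh i) (lsh j) = - antisym A n N.
Proof.
move=> ij; rewrite -Pperm_tperm /antisym -mulrA -mulrN; congr (_ * _).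
rewrite mulr_suml -sumrN [RHS](reindex_inj (mulIg (tperm i j))) /=.
apply: eq_bigr => s _; rewrite -mulrA PpermM odd_permM odd_tperm ij addbT.
by rewrite -mulNr; congr (_ * _); case: (odd_perm s); rewrite /= ?expr0 ?expr1 !csE scaleNr asopN ?opprK.
Qed.

Lemma antisym_mull i j : i != j -> Pmx A n (lsh i) (lsh j) * antisym A n N = - antisym A n N.
Proof.
move=> ij; rewrite -Pperm_tperm /antisym mulrA -cs_central -mulrA -mulrN; congr (_ * _).
rewrite mulr_sumr -sumrN [RHS](reindex_inj (mulgI (tperm i j))) /=.
apply: eq_bigr => s _; rewrite mulrA -cs_central -mulrA PpermM odd_permM odd_tperm ij addTb.
by rewrite -mulNr; congr (_ * _); case: (odd_perm s); rewrite /= ?expr0 ?expr1 !csE scaleNr asopN ?opprK.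
Qed.

Definition aux_id (xi : idx n N) : idx n (n + N) :=
  [ffun p => match split p with inl i => i | inr j => xi j end].

Lemma aux_id_l xi i : aux_id xi (lsh i) = i.
Proof. by rewrite ffunE; have := unsplitK (inl i : 'I_n + 'I_N) => /= ->. Qed.

Lemma aux_id_r xi j : aux_id xi (rsh j) = xi j.
Proof. by rewrite ffunE; have := unsplitK (inr j : 'I_n + 'I_N) => /= ->. Qed.

(* An alternating function of the auxiliary indices vanishes when two of them
   agree, and otherwise is determined by its value at the identity. *)
Lemma alternating_eq0 (V : lmodType C) (phi : idx n (n + N) -> V) :
  (forall i j, i != j -> forall x, phi (pm (tperm (lsh i) (lsh j)) x) = - phi x) ->
  (forall xi, phi (aux_id xi) = 0) -> forall x, phi x = 0.
Proof.
move=> alt phi0 x.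
have alt_perm (s : 'S_n) z : phi z = 0 -> phi (pm (aux_perm s) z) = 0.
  have [ts -> dts] := prod_tpermP s.
  elim: ts dts z => [_|[i j] ts IH] /=.
    move=> z; rewrite big_nil; rewrite (_ : pm _ z = z) //.
    by apply/ffunP => p; rewrite ffunE aux_perm1.
  case/andP=> ij dts z phiz; rewrite big_cons /=.
  rewrite (_ : pm _ z = pm (tperm (lsh i) (lsh j))
    (pm (aux_perm (\prod_(t <- ts) tperm t.1 t.2)%g) z)).
    by rewrite alt // IH ?oppr0.
  by apply/ffunP => p; rewrite !ffunE aux_permM aux_perm_tperm.
pose l i := x (lsh i).
have [/injectiveP l_inj|/injectivePn[i [j ij lij]]] := boolP (injectiveb l); last first.
  apply: eq_opp_eq0; rewrite -(alt i j ij); congr phi.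
  apply/ffunP => p; rewrite ffunE; case: tpermP => // ->; first exact: lij.
  exact/esym/lij.
rewrite (_ : x = pm (aux_perm (perm l_inj)) (aux_id [ffun j => x (rsh j)])).
  exact/alt_perm/phi0.
apply/ffunP => p; rewrite ffunE; elim/split_ind: p => i.
  by rewrite aux_perm_l aux_id_l permE.
by rewrite aux_perm_r aux_id_r ffunE.
Qed.

Lemma alternating_op_eq0 (W : S) :
  (forall i j, i != j -> W * Pmx A n (lsh i) (lsh j) = - W) ->
  (forall i j, i != j -> Pmx A n (lsh i) (lsh j) * W = - W) ->
  (forall xi eta, ent W (aux_id xi) (aux_id eta) = 0) -> W = 0.
Proof.
have entN (X : S) x y : ent (- X) x y = - ent X x y by rewrite /ent mxE.
move=> altR altL W0; apply: op_ext => x z; rewrite {2}/ent mxE.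
move: x; apply: alternating_eq0.
  move=> i j ij x; have := altL i j ij => /(congr1 (fun X => ent X (pm (tperm (lsh i) (lsh j)) x) z)).
  rewrite PmxE entN (@ent_posop_mul _ _ _ _ (tperm (lsh i) (lsh j))); last 2 first.
  - by move=> p; rewrite tpermK.
  - by move=> p; rewrite tpermK.
  by move=> ->; rewrite opprK.
move=> xi; move: z; apply: alternating_eq0 => [i j ij z|]; last exact: W0.
by rewrite -entN -(altR i j ij) PmxE ent_mul_posop.
Qed.

Lemma off_rshift (x y : idx n (n + N)) : off rsh x y = [forall i, x (lsh i) == y (lsh i)].
Proof.
apply/forallP/forallP => [xy i|xy p].
  have /implyP := xy (lsh i); apply; apply/negP => /codomP[j /eqP].
  by rewrite eq_lrshift.
by elim/split_ind: p => i; [rewrite xy implybT|rewrite codom_f].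
Qed.

Lemma emb_rshift_Pperm (Q : op A n N) (s : 'S_n) : GRing.comm (emb rsh Q) (Pperm A N s).
Proof.
have sK : cancel (aux_perm s) (aux_perm s^-1).
  by move=> p; rewrite -aux_permM mulgV aux_perm1.
have Ks : cancel (aux_perm s^-1) (aux_perm s).
  by move=> p; rewrite -aux_permM mulVg aux_perm1.
apply: op_ext => x z; rewrite PpermE ent_mul_posop.
have -> : x = pm (aux_perm s) (pm (aux_perm s^-1) x).
  by apply/ffunP => p; rewrite !ffunE sK.
rewrite (ent_posop_mul _ _ _ Ks sK); move: (pm _ x) => {}x.
rewrite !ent_emb !pm_comp.
have E (u : idx n (n + N)) : pm (aux_perm s \o rsh) u = pm rsh u.
  by apply/ffunP => p; rewrite !ffunE /= aux_perm_r.
rewrite !E; congr (_ * (nat_of_bool _)%:R); rewrite !off_rshift.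
apply/forallP/forallP => xz i; last by rewrite !ffunE aux_perm_l.
have := xz ((s^-1)%g i); by rewrite !ffunE aux_perm_l permKV.
Qed.

Lemma ent_antisym_emb (Q : op A n N) xi eta :
  ent (antisym A n N * emb rsh Q) (aux_id xi) (aux_id eta) =
  (n`!%:R)^-1 *: ent Q xi eta.
Proof.
have ent_cs c (X : S) x y : ent (cs A n (n + N) c * X) x y = c *: ent X x y.
  rewrite entM (bigD1 x) //= csE ent_scalar eqxx mulr1n big1 ?addr0 ?mulr_algl //.
  by move=> z ne; rewrite ent_scalar eq_sym (negbTE ne) mul0r.
have ent_off (s : 'S_n) : ent (Pperm A N s * emb rsh Q) (aux_id xi) (aux_id eta) =
    ent Q xi eta *+ (s == 1%g).
  rewrite -emb_rshift_Pperm PpermE ent_mul_posop ent_emb pm_comp.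
  have pmE : pm rsh (aux_id xi) = xi by apply/ffunP => j; rewrite ffunE aux_id_r.
  have -> : pm (aux_perm s \o rsh) (aux_id eta) = eta.
    by apply/ffunP => j; rewrite ffunE /= aux_perm_r aux_id_r.
  rewrite pmE -[RHS]mulr_natr; congr (_ * (nat_of_bool _)%:R); rewrite off_rshift.
  apply/forallP/eqP => [E|-> i];
    last by rewrite [pm _ _ _]ffunE aux_perm1 !aux_id_l.
  apply/permP => i; have := E i.
  by rewrite [pm _ _ _]ffunE aux_perm_l !aux_id_l perm1 => /eqP.
rewrite /antisym -mulrA ent_cs mulr_suml; congr (_ *: _).
rewrite (big_morph (fun X : S => ent X (aux_id xi) (aux_id eta)) (id1 := 0) (op1 := +%R)).
- rewrite (bigD1 1%g) //= big1 ?addr0 => [|s /negbTE s1].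
    by rewrite -mulrA ent_cs ent_off eqxx odd_perm1 expr0 scale1r.
  by rewrite -mulrA ent_cs ent_off s1 scaler0.
- by move=> X Y; rewrite entD.
by rewrite /ent mxE.
Qed.

Lemma antisym_factor (Y : S) :
  (forall i j, i != j -> Y * Pmx A n (lsh i) (lsh j) = - Y) ->
  (forall i j, i != j -> Pmx A n (lsh i) (lsh j) * Y = - Y) ->
  exists Q : op A n N, antisym A n N * emb rsh Q = Y.
Proof.
move=> altR altL.
pose Q : op A n N := \matrix_(x, y) (n`!%:R *: ent Y (aux_id (eidx x)) (aux_id (eidx y))).
exists Q; apply: subr0_eq; apply: alternating_op_eq0 => [i j ij|i j ij|xi eta].
- rewrite mulrBl altR // -mulrA -Pperm_tperm emb_rshift_Pperm Pperm_tperm mulrA.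
  by rewrite antisym_mulr // mulNr opprD.
- by rewrite mulrBr altL // mulrA antisym_mull // mulNr opprD.
rewrite entD ent_antisym_emb {1}/ent mxE /eidx !enum_rankK scalerA mulVf ?scale1r.
  by rewrite /ent mxE subrr.
by rewrite pnatr_eq0 -lt0n fact_gt0.
Qed.
End Antisymmetrizer.

(** * Fusion and the quantum determinant *)

Section Shift.
Variables (C : fieldType) (A : algType C) (n M : nat).
Local Notation S := (op A n M).
Local Notation cs := (@cs C A n M).

(* The expansion of [(u - c)^-1]. *)
Definition ser_pole (c : C) : ser S := fun k => if k == 0%N then 0 else cs (c ^+ k.-1).

Lemma ser_pole_rec c :
  ser_pole c = ser_X S + ser_cst (cs c) * (ser_X S * ser_pole c).
Proof.
apply: funext => k; rewrite ser_addE [X in _ + X]ser_cst_mulE ser_XmE /ser_pole /ser_X.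
case: k => [|[|k]]; rewrite /= ?mulr0 ?addr0 ?expr0 ?cs1 //.
by rewrite add0r exprS csM.
Qed.

Lemma ser_pole_coef_comm c k a : GRing.comm (ser_pole c k) a.
Proof.
rewrite /ser_pole; case: ifP => _; last exact: cs_central.
by apply/commr_sym/commr0.
Qed.

Lemma ser_pole_central c : central (ser_pole c).
Proof. by move=> f; apply: subst_var_comm; apply: ser_pole_coef_comm. Qed.

Lemma ser_pole_expE c k m : (ser_pole c ^+ k) m =
  if (k <= m)%N then cs (c ^+ (m - k) * ('C(m.-1, m - k))%:R) else 0.
Proof.
elim: m k => [|m IH] [|k].
- by rewrite expr0 ser_oneE /= bin0 mulr1 expr0 cs1.
- by rewrite ser_exp_lt.
- by rewrite expr0 ser_oneE subn0 bin_small //= mulr0 cs0.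
have -> : ser_pole c ^+ k.+1 = ser_X S * ser_pole c ^+ k +
    ser_cst (cs c) * (ser_X S * ser_pole c ^+ k.+1).
  by rewrite exprS {1}ser_pole_rec mulrDl -!mulrA.
rewrite ser_addE [X in _ + X]ser_cst_mulE !ser_XmE !IH ltnS subSS /=.
case: ltngtP => [lt_km|lt_mk|<-]; last 2 first.
- by rewrite mulr0 addr0.
- by rewrite mulr0 addr0 subnn !bin0.
have [j mkj] : exists j, (m - k)%N = j.+1 by exists (m - k).-1; lia.
have -> : (m - k.+1)%N = j by lia.
have {lt_km} m1 : m.-1.+1 = m by lia.
rewrite mkj -csM mulrA -exprS -csD -mulrDr -natrD; congr (cs (_ * _%:R)).
by rewrite -[in RHS]m1 binS.
Qed.

Lemma ser_shiftE c (f : ser S) : ser_shift c f = ser_subst (ser_pole c) f.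
Proof.
apply: funext => m; rewrite /ser_shift /ser_subst; apply: eq_bigr => k _.
by rewrite ser_pole_expE -ltnS ltn_ord.
Qed.

Lemma ser_pole_diff c e :
  ser_pole (c + e) - ser_pole c = ser_cst (cs e) * ser_pole c * ser_pole (c + e).
Proof.
set y := ser_pole c; set z := ser_pole (c + e); pose x := ser_X S.
apply: ser_X_inj; rewrite -/x.
have xC : central x by apply: ser_X_central.
have cC b : central (ser_cst (cs b)) by apply/ser_cst_central/cs_central.
have yz : y * z = x * z + ser_cst (cs c) * (x * (y * z)).
  by rewrite {1}/y ser_pole_rec mulrDl -!mulrA.
have zy : y * z = x * y + ser_cst (cs c) * (x * (y * z)) + ser_cst (cs e) * (x * (y * z)).
  rewrite {1}/z ser_pole_rec -/z mulrDr -(xC y) csD rmorphD mulrDl -addrA; congr (_ + _).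
  have E b : y * (ser_cst (cs b) * (x * z)) = ser_cst (cs b) * (x * (y * z)).
    by rewrite mulrA -cC -mulrA; congr (_ * _); rewrite !mulrA xC.
  by rewrite mulrDr !E.
have : x * z = x * y + ser_cst (cs e) * (x * (y * z)).
  by apply: (@addIr _ (ser_cst (cs c) * (x * (y * z)))); rewrite -yz {1}zy addrAC.
rewrite mulrBr => ->; rewrite addrC addKr.
by rewrite !mulrA -(cC _ x).
Qed.
End Shift.

Section AuxCopies.
Variables (C : numFieldType) (A : algType C) (n N : nat) (lam : C) (d : nat -> A).
Hypothesis dd : forall i j, (1 <= i <= N)%N -> (1 <= j <= N)%N -> d i * d j = d j * d i.
Local Notation S1 := (op A n (1 + N)).
Local Notation S := (op A n (n + N)).
Local Notation lsh := (@lshift n N).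
Local Notation rsh := (@rshift n N).

Lemma aux_copy_l a i : aux_copy a (lshift N i) = lsh a.
Proof. by rewrite /aux_copy; have := unsplitK (inl i : 'I_1 + 'I_N) => /= ->. Qed.

Lemma aux_copy_r (a : 'I_n) j : aux_copy a (rshift 1 j) = rsh j.
Proof. by rewrite /aux_copy; have := unsplitK (inr j : 'I_1 + 'I_N) => /= ->. Qed.

Lemma aux_copy_inj (a : 'I_n) : injective (@aux_copy n N a).
Proof.
move=> p q; elim/split_ind: p => i; elim/split_ind: q => j;
  rewrite ?aux_copy_l ?aux_copy_r.
- by move=> _; rewrite (ord1 i) (ord1 j).
- by move/eqP; rewrite eq_lrshift.
- by move/eqP; rewrite eq_rlshift.
by move/rshift_inj->.
Qed.

Definition shifted_copy (a : 'I_n) (f : ser S1) : ser S :=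
  fun k => emb (aux_copy a) (ser_shift (a%:R * lam) f k).

Section Morphism.
Variable a : 'I_n.
Let inj := @aux_copy_inj a.
Let y := ser_pole A n (1 + N) (a%:R * lam).
Let y0 : y 0%N = 0. Proof. by []. Qed.
Let yC : forall k b, GRing.comm (y k) b.
Proof. exact: ser_pole_coef_comm. Qed.
Local Notation e := (@emb A n (1 + N) (n + N) (aux_copy a)).

Lemma shifted_copyE f : shifted_copy a f = ser_map e (ser_subst y f).
Proof. by rewrite /shifted_copy ser_shiftE. Qed.

Lemma shifted_copyD : {morph shifted_copy a : f g / f + g}.
Proof. by move=> f g; rewrite !shifted_copyE ser_substD (ser_mapD (embD _)). Qed.

Lemma shifted_copyM : {morph shifted_copy a : f g / f * g}.
Proof.
by move=> f g; rewrite !shifted_copyE ser_substM // (ser_mapM (embD _) (emb0 _ _ _) (embM inj)).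
Qed.

Lemma shifted_copy_cst c : shifted_copy a (ser_cst c) = ser_cst (e c).
Proof. by rewrite shifted_copyE ser_subst_cst (ser_map_cst (emb0 _ _ _)). Qed.

Lemma shifted_copy1 : shifted_copy a 1 = 1.
Proof. by rewrite shifted_copy_cst emb1. Qed.

Lemma shifted_copyX : shifted_copy a (ser_X S1) = ser_pole A n (n + N) (a%:R * lam).
Proof.
rewrite shifted_copyE ser_substX //; apply: funext => -[|k]; rewrite /ser_map.
  exact: emb0.
exact: emb_asop.
Qed.
End Morphism.

Local Notation T := (Tser n (@rshift 1 N) lam (lshift N (ord0 : 'I_1)) d).
Local Notation L i := (Lser n lam (lshift N (ord0 : 'I_1)) (rshift 1 i) (d (nat_of_ord i).+1)).
Local Notation Paux a b := (ser_cst (Pmx A n (lsh a) (lsh b)) : ser S).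

Lemma shifted_copy_T a : shifted_copy a T = \prod_(i <- enum 'I_N) shifted_copy a (L i).
Proof.
rewrite /Tser ser_prodE.
exact: (big_morph _ (@shifted_copyM a) (shifted_copy1 a)).
Qed.

Lemma shifted_copy_lax a i :
  lax_op (shifted_copy a (L i)) (ser_cst (asop n (n + N) (d i.+1)))
    (ser_cst (Pmx A n (lsh a) (rsh i))) (ser_cst (cs A n (n + N) lam))
    (ser_pole A n (n + N) (a%:R * lam)).
Proof.
have := lax_op_morph (@shifted_copyD a) (@shifted_copyM a) (shifted_copy1 a)
  (Lser_lax n lam (lshift N (ord0 : 'I_1)) (rshift 1 i) (d i.+1)).
have inj := @aux_copy_inj a.
rewrite !shifted_copy_cst shifted_copyX !emb_asop (emb_Pmx _ _ inj).
by rewrite aux_copy_l aux_copy_r.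
Qed.

Let lC : central (ser_cst (cs A n (n + N) lam)).
Proof. exact/ser_cst_central/cs_central. Qed.

Let DP (e : A) p p' : GRing.comm (ser_cst (asop n (n + N) e)) (ser_cst (Pmx A n p p')).
Proof. exact/ser_cst_comm/asop_posop. Qed.

Lemma shifted_copy_fusion (a b : 'I_n) : b = a.+1 :> nat ->
  (1 - Paux a b) * (shifted_copy a T * shifted_copy b T) =
  shifted_copy b T * shifted_copy a T * (1 - Paux a b).
Proof.
move=> ba; rewrite !shifted_copy_T.
have ab : lsh a != lsh b.
  by rewrite (inj_eq (@lshift_inj n N)) -val_eqE /= ba neq_ltn ltnSn.
have off_ r i : rsh i != lsh r by rewrite eq_rlshift.
apply: exchange_prod; first exact: enum_uniq.
- move=> i _; rewrite -[Paux a b]mul1r.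
  have [R1 R2 R3 R4] := Pmx_triple A n ab (off_ a i) (off_ b i).
  rewrite !(Pmx_sym A n (rsh i)) in R1 R2 R3 R4.
  apply: (lax_op_rtt (shifted_copy_lax a i) (shifted_copy_lax b i)).
  - by rewrite -!rmorphM R1.
  - by rewrite -!rmorphM R2.
  - by rewrite -!rmorphM R3.
  - by rewrite -!rmorphM R4.
  - by move=> z; rewrite !inE => /or3P[] /eqP->; apply: DP.
  - exact: lC.
  - exact: ser_pole_central.
  - exact: ser_pole_central.
  - by move=> z; apply/commr_sym/commr1.
  - by move=> z; apply/commr_sym/commr1.
  rewrite !mul1r ba -natr1 mulrDl mul1r ser_pole_diff -!mulrA; congr (_ * _).
  by rewrite mulrA -(lC (ser_pole _ _ _ _)) -mulrA.
move=> i j _ _ ij.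
apply: (lax_op_comm (shifted_copy_lax a i) (lC)); first exact: ser_pole_central.
  apply/commr_sym/(lax_op_comm (shifted_copy_lax b j) (lC)); first exact: ser_pole_central.
    by apply: ser_cst_comm; rewrite /GRing.comm -!asopM dd ?ltn_ord.
  exact/commr_sym/DP.
apply/commr_sym/(lax_op_comm (shifted_copy_lax b j) (lC)); first exact: ser_pole_central.
  exact: DP.
by apply/ser_cst_comm/Pmx_comm; rewrite ?eq_lrshift ?eq_rlshift ?(inj_eq (@lshift_inj n N))
  ?(inj_eq (@rshift_inj n N)) // -?val_eqE /= ?ba ?neq_ltn ?ltnSn.
Qed.

Lemma shifted_copy_Paux (a b c : 'I_n) : c != a -> c != b ->
  GRing.comm (Paux a b) (shifted_copy c T).
Proof.
move=> ca cb; rewrite shifted_copy_T; apply: commr_prod => i _; apply/commr_sym.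
apply: (lax_op_comm (shifted_copy_lax c i) (lC)); first exact: ser_pole_central.
  exact: DP.
apply/ser_cst_comm/Pmx_comm;
  rewrite ?eq_lrshift ?eq_rlshift ?(inj_eq (@lshift_inj n N)) //; by rewrite eq_sym.
Qed.

Definition qdet_series : ser S :=
  ser_cst (antisym A n N) * \prod_(a <- enum 'I_n) shifted_copy a T.

Lemma qdet_alt_adjacent (a b : 'I_n) : b = a.+1 :> nat ->
  qdet_series * Paux a b = - qdet_series.
Proof.
move=> ba; pose F c := shifted_copy c T; set P := Paux a b.
have ab : a != b by rewrite -val_eqE /= ba neq_ltn ltnSn.
have [s1 [s2 enumE]] : exists s1 s2, enum 'I_n = s1 ++ a :: b :: s2.
  exists (take a (enum 'I_n)), (drop b.+1 (enum 'I_n)).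
  have nthE (c : 'I_n) : nth a (enum 'I_n) c = c by apply/val_inj; rewrite /= nth_enum_ord.
  rewrite -{1}(cat_take_drop a (enum 'I_n)); congr (_ ++ _).
  by rewrite (drop_nth a) ?size_enum_ord // nthE -ba (drop_nth a) ?size_enum_ord // nthE.
have := enum_uniq 'I_n; rewrite enumE cat_uniq /= => /and4P[_ has1 _ _].
move: (enum_uniq 'I_n); rewrite enumE uniq_catC /= !inE !mem_cat !negb_or.
move=> /and3P[/and3P[_ as2 as1] /andP[bs2 bs1] _].
have PF (s : seq 'I_n) : a \notin s -> b \notin s -> GRing.comm P (\prod_(c <- s) F c).
  move=> as_ bs; rewrite big_seq; apply: commr_prod => c cs.
  by apply: shifted_copy_Paux; [apply: contraNneq as_ => <-|apply: contraNneq bs => <-].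
have PP : P * P = 1.
  by rewrite -rmorphM !PmxE posopM (eq_posop _ _ (tpermK _ _)) posop_id rmorph1.
set f1 := \prod_(c <- s1) F c; set f2 := \prod_(c <- s2) F c.
have Pf1 : GRing.comm P f1 by apply: PF.
have Pf2 : GRing.comm P f2 by apply: PF.
pose X := F a * F b; pose An : ser S := ser_cst (antisym A n N).
have YE : qdet_series = An * f1 * X * f2.
  by rewrite /qdet_series enumE big_cat !big_cons /= !mulrA.
have AnP : An * P = - An.
  rewrite -rmorphM antisym_mulr ?rmorphN //.
have P0 : (1 - P) * (1 + P) = 0.
  by rewrite mulrDr mulr1 mulrBl mul1r PP addrC -(opprB 1 P) addNr.
have X1P : X * (1 + P) = P * X * (1 + P).
  apply: subr0_eq; rewrite -mulrBl -{1}[X]mul1r -mulrBl shifted_copy_fusion // -/P.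
  by rewrite -[LHS]mulrA P0 mulr0.
have f2P : f2 * (1 + P) = (1 + P) * f2 by rewrite mulrDr mulrDl mulr1 mul1r Pf2.
have Y1P : qdet_series * (1 + P) = - (qdet_series * (1 + P)).
  rewrite YE -[LHS]mulrA f2P mulrA -(mulrA _ X) X1P !mulrA -[An * f1 * P]mulrA -Pf1 mulrA AnP.
  by rewrite -[_ * (1 + P) * f2]mulrA -f2P !mulNr !mulrA.
have Y0 : qdet_series * (1 + P) = 0.
  apply: funext => k; apply: op_ext => x z.
  rewrite [RHS]mxE; apply: (@eq_opp_eq0 C A).
  have /(congr1 (fun f : ser S => ent (f k) x z)) := Y1P.
  by rewrite [X in _ = X -> _]mxE.
by apply/eqP; rewrite -addr_eq0 addrC -{1}[qdet_series]mulr1 -mulrDr Y0.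
Qed.

Lemma qdet_alt (a b : 'I_n) : a != b -> qdet_series * Paux a b = - qdet_series.
Proof.
wlog lt_ab : a b / (a < b)%N => [hw ab|_].
  have [lt|gt|E] := ltngtP a b; first exact: hw.
    by rewrite Pmx_sym; apply: hw; rewrite 1?eq_sym.
  by move/eqP: ab; case; apply: val_inj.
move e: (b - a)%N => m; elim: m a e lt_ab => [|m IH] a e lt_ab; first lia.
have [ba|nba] := eqVneq (b : nat) a.+1; first exact: qdet_alt_adjacent.
have lt_n : (a.+1 < n)%N by have := ltn_ord b; lia.
pose c := Ordinal lt_n.
have ca : c = a.+1 :> nat by [].
have cb : qdet_series * Paux c b = - qdet_series by apply: IH => /=; lia.
have PE : Pmx A n (lsh a) (lsh b) =
    Pmx A n (lsh a) (lsh c) * Pmx A n (lsh c) (lsh b) * Pmx A n (lsh a) (lsh c).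
  rewrite !PmxE !posopM; apply: eq_posop => p /=.
  by rewrite tperm_through // (inj_eq (@lshift_inj n N)) -val_eqE /=; lia.
rewrite PE !rmorphM !mulrA (qdet_alt_adjacent ca) !mulNr cb mulNr (qdet_alt_adjacent ca).
by rewrite !opprK.
Qed.

Lemma qdet_exists : exists Q, is_qdet lam T Q.
Proof.
have qdetk k : exists Q : op A n N, antisym A n N * emb rsh Q = qdet_series k.
  apply: antisym_factor => i j ij.
    have := congr1 (fun f : ser S => f k) (qdet_alt ij).
    by rewrite ser_mulE ser_mul_cstE.
  by rewrite /qdet_series ser_mulE ser_cst_mulE mulrA antisym_mull // mulNr.
have [Q QE] := choice qdetk.
exists Q; apply: funext => k; rewrite ser_cst_mulE QE.
by rewrite ser_prodE.
Qed.
End AuxCopies.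

Lemma prod_absorbing (B : pzRingType) (I : Type) (s : seq I) (F : I -> B) (e : B) :
  e * e = e -> (forall i, e * (F i * e) = F i * e) -> (0 < size s)%N ->
  \prod_(i <- s) (F i * e) = (\prod_(i <- s) F i) * e.
Proof.
move=> ee eF; case: s => // i s _.
have e_prod (r : seq I) : e * ((\prod_(j <- r) F j) * e) = (\prod_(j <- r) F j) * e.
  elim: r => [|j r IH]; first by rewrite big_nil mul1r.
  by rewrite big_cons -mulrA -IH !mulrA -(mulrA e) eF.
elim: s i => [|j s IH] i; first by rewrite !big_seq1.
by rewrite big_cons IH -mulrA e_prod [in RHS]big_cons mulrA.
Qed.

Section EmbedLambda.
Variables (C : fieldType) (A : algType C) (n M M' N : nat) (tau : C).
Variables (Pg : nat -> A) (qp : 'I_N -> 'I_M) (s : 'I_M -> 'I_M').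

Lemma emb_Lambda1 : injective s ->
  emb s (Lambda1 n qp tau Pg) = Lambda1 n (s \o qp) tau Pg.
Proof.
move=> s_inj; have embS := big_morph _ (embD s) (emb0 A n s).
have embP := big_morph _ (embM s_inj) (emb1 A n s).
rewrite /Lambda1 (embM s_inj) emb_asop embP; congr (_ * _).
apply: eq_bigr => j _; rewrite embD emb1 (embM s_inj) emb_asop embS.
congr (_ + _ * _); apply: eq_bigr => i _.
by rewrite (embM s_inj) emb_Pmx // emb_asop.
Qed.
End EmbedLambda.

Lemma eq_Lambda1 (C : fieldType) (A : algType C) (n M N : nat) (tau : C) (Pg : nat -> A)
    (q q' : 'I_N -> 'I_M) : q =1 q' -> Lambda1 n q tau Pg = Lambda1 n q' tau Pg.
Proof. by move=> /funext ->. Qed.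

Lemma nat_labels (N M : nat) (qp : 'I_N -> 'I_M) : (0 < N)%N ->
  exists q : nat -> 'I_M, forall i : 'I_N, qp i = q i.
Proof.
by case: N qp => // N qp _; exists (fun i => qp (inord i)) => i; rewrite inord_val.
Qed.

Section QdetLambda.
Variables (C : numFieldType) (A : algType C) (n N : nat) (lam tau : C) (d Pg : nat -> A).
Hypotheses (n_gt0 : (0 < n)%N) (N_gt0 : (0 < N)%N) (tau2 : tau * tau = 1).
Hypothesis rel : dAHA_rel N (tau * lam) d Pg.

Lemma qdet_Lambda1 (Q : ser (op A n N)) :
  let T := Tser n (@rshift 1 N) lam (lshift N (ord0 : 'I_1)) d in
  let TL := ser_mul T (ser_cst (Lambda1 n (@rshift 1 N) tau Pg)) in
  let LamQ := Lambda1 n (fun i : 'I_N => i) tau Pg in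
  is_qdet lam T Q -> is_qdet lam TL (ser_mul Q (ser_cst LamQ)).
Proof.
move=> T TL LamQ; rewrite /is_qdet !ser_prodE => QE.
have rshift_inj' m : injective (@rshift m N) by apply: rshift_inj.
pose La := Lambda1 n (@rshift n N) tau Pg.
have [q qE] := nat_labels (@rshift n N) N_gt0.
have [q1 q1E] := nat_labels (@rshift 1 N) N_gt0.
have q_inj := q_inj_on qE (rshift_inj' n).
have q1_inj := q_inj_on q1E (rshift_inj' 1%N).
have LL : La * La = La.
  apply: (@Lambda1_absorb C A n _ N tau Pg q _ tau2 qE q_inj) => k k1 kN.
  exact: (@signed_swap_Lambda1 C A n _ N lam tau d Pg q _ tau2 rel qE q_inj).
have fixT : ser_cst (Lambda1 n (@rshift 1 N) tau Pg) * TL = TL.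
  apply: funext => m; rewrite ser_mulE ser_cst_mulE [TL m]ser_mul_cstE.
  apply: (@Lambda1_Tser C A n _ N lam tau d Pg q1 _ tau2 rel q1E q1_inj) => i iN.
  by rewrite -(q1E (Ordinal iN)) eq_lrshift.
have copyL a : shifted_copy lam a (ser_cst (Lambda1 n (@rshift 1 N) tau Pg)) = ser_cst La.
  rewrite shifted_copy_cst emb_Lambda1; last exact: aux_copy_inj.
  by congr ser_cst; apply: eq_Lambda1 => i /=; rewrite aux_copy_r.
have copyTL a : shifted_copy lam a TL = shifted_copy lam a T * ser_cst La.
  by rewrite -(copyL a) -shifted_copyM.
have prodE : \prod_(a <- enum 'I_n) shifted_copy lam a TL =
    (\prod_(a <- enum 'I_n) shifted_copy lam a T) * ser_cst La.
  rewrite (eq_bigr _ (fun a _ => copyTL a)) prod_absorbing ?size_enum_ord //.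
    by rewrite -rmorphM LL.
  by move=> a; rewrite -copyTL -{1}(copyL a) -shifted_copyM fixT.
have embL : emb (@rshift n N) LamQ = La.
  by rewrite emb_Lambda1 //; apply: eq_Lambda1.
have -> : (fun k => emb (@rshift n N) (ser_mul Q (ser_cst LamQ) k)) =
    ser_mul (fun k => emb (@rshift n N) (Q k)) (ser_cst La).
  by apply: funext => k; rewrite !ser_mul_cstE (embM (rshift_inj' n)) embL.
rewrite [LHS](mulrA (ser_cst (antisym A n N))) [X in X * _]QE.
rewrite -[RHS]/(ser_cst (antisym A n N) * \prod_(a <- enum 'I_n) shifted_copy lam a TL).
by rewrite prodE mulrA.
Qed.
End QdetLambda.

Theorem theorem3 (R : realType) (A : algType R[i]) (N n : nat)
    (lam tau : R[i]) (d Pg : nat -> A) :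
  (2 <= N)%N -> (1 <= n)%N -> (tau = 1 \/ tau = -1) ->
  dAHA_rel N (tau * lam) d Pg ->
  let a0 : 'I_(2 + N) := lshift N (ord0 : 'I_2) in
  let a0' : 'I_(2 + N) := lshift N (ord_max : 'I_2) in
  let Lam := Lambda1 n (@rshift 2 N) tau Pg in
  let T0L := ser_mul (Tser n (@rshift 2 N) lam a0 d) (ser_cst Lam) in
  let T0'L := ser_mul (Tser n (@rshift 2 N) lam a0' d) (ser_cst Lam) in
  let T := Tser n (@rshift 1 N) lam (lshift N (ord0 : 'I_1)) d in
  let TL := ser_mul T (ser_cst (Lambda1 n (@rshift 1 N) tau Pg)) in
  let LamQ := Lambda1 n (fun i : 'I_N => i) tau Pg in
  bser_mul (Rnorm A n lam a0 a0') (bser_mul (in_u T0L) (in_v T0'L))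
  = bser_mul (bser_mul (in_v T0'L) (in_u T0L)) (Rnorm A n lam a0 a0')
  /\ (exists Q, is_qdet lam T Q)
  /\ (forall Q, is_qdet lam T Q -> is_qdet lam TL (ser_mul Q (ser_cst LamQ))).
Proof.
move=> N2 n1 tau1 rel a0 a0' Lam T0L T0'L T TL LamQ.
have tau2 : tau * tau = 1 by case: tau1 => ->; rewrite ?mulr1 ?mulrNN ?mulr1.
have N_gt0 : (0 < N)%N by apply: leq_trans N2.
split; last split.
- have [q qE] := nat_labels (@rshift 2 N) N_gt0.
  have rshift_injN : injective (@rshift 2 N) by apply: rshift_inj.
  have off_q (b : 'I_2) i : lshift N b != rshift 2 i by rewrite eq_lrshift.
  have a00' : a0 != a0' by [].
  exact: (@RTT_Lambda1 _ A n _ N lam tau d Pg q _ a0 a0' tau2 rel qE rshift_injN a00'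
    (off_q _) (off_q _)).
- apply: qdet_exists => i j /andP[? ?] /andP[? ?].
  by case: rel => _ [_ [_ [_ [_ [_ dd]]]]]; apply: dd.
by move=> Q; apply: qdet_Lambda1.
Qed.
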